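(* Fix $0<\rho<1$ and let $\{\omega_x,I_{ie_1},J_{je_2}:x\in\mathbb Z_{>0}^2,\ i,j\in\mathbb Z_{>0}\}$ be mutually independent with $\omega_x\sim\mathrm{Exp}(1)$, $I_{ie_1}\sim\mathrm{Exp}(1-\rho)$, $J_{je_2}\sim\mathrm{Exp}(\rho)$. Let $a_0$ be a fixed positive constant. Then there exists a constant $0<C=C(\rho,a_0)<\infty$ such that $$C^{-1}N^{2/3}\le\mathrm{Var}[G^\rho_{0,(m,n)}]\le CN^{2/3}$$ holds for all $(m,n)\in\mathbb Z_{>0}^2$ and $N\ge1$ for which $$\kappa_N=|m-N(1-\rho)^2|\vee|n-N\rho^2|$$ satisfies $\kappa_N\le a_0N^{2/3}$.
   Context: $e_1=(1,0)$, $e_2=(0,1)$; $\mathrm{Exp}(\lambda)$ is the exponential distribution with rate $\lambda$; $a\vee b=\max\{a,b\}$. The stationary last-passage process is $G^\rho_{0,0}=0$, $G^\rho_{0,me_1}=\sum_{i=1}^mI_{ie_1}$, $G^\rho_{0,ne_2}=\sum_{j=1}^nJ_{je_2}$, and $G^\rho_{0,x}=\omega_x+G^\rho_{0,x-e_1}\vee G^\rho_{0,x-e_2}$ for $x\in\mathbb Z_{>0}^2$. Equivalently, $G^\rho_{0,(m,n)}$ is the maximal sum of weights along up-right paths from $0$ to $(m,n)$ with increments in $\{e_1,e_2\}$, where the weight at $ie_1$ is $I_{ie_1}$, at $je_2$ is $J_{je_2}$, at $x\in\mathbb Z_{>0}^2$ is $\omega_x$, and at $0$ is $0$. *)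

(* Defs.v *)
From HB Require Import structures.
From mathcomp Require Import all_boot all_order all_algebra finmap.
From mathcomp Require Import all_classical all_reals all_analysis.
Set Implicit Arguments.
Unset Strict Implicit.
Unset Printing Implicit Defensive.
Import Order.TTheory GRing.Theory Num.Theory.
Local Open Scope classical_set_scope.
Local Open Scope ring_scope.

(* Library measures are total functions on [set T]; both notions below only
   constrain their values on measurable sets. *)
Definition has_exponential_law (d : measure_display) (T : measurableType d)
    (R : realType) (P : probability T R) (rate : R) (X : {RV P >-> R}) : Prop :=
  forall A : set R, measurable A -> distribution P X A = exponential_prob rate A.

Definition mutually_independent_on (d : measure_display) (T : measurableType d)
    (R : realType) (P : probability T R) (K : choiceType) (D : set K)
    (X : K -> {RV P >-> R}) : Prop :=
  forall (F : {fset K}) (A : K -> set R),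
    [set` F] `<=` D ->
    (forall k, k \in F -> measurable (A k)) ->
    P (\bigcap_(k in [set` F]) (X k @^-1` A k)) =
    (\prod_(k <- F) P (X k @^-1` A k))%E.

(* [omega i j] is the weight at (i,j), [I i] the one at i e_1 and [J j] the one
   at j e_2; only the values at positive [i] and [j] are used. *)
Definition lattice_weight (d : measure_display) (T : measurableType d)
    (R : realType) (P : probability T R) (omega : nat -> nat -> {RV P >-> R})
    (I J : nat -> {RV P >-> R}) (x : nat * nat) : {RV P >-> R} :=
  match x with
  | (0, 0)%N => cst 0
  | (i.+1, 0)%N => I i.+1
  | (0, j.+1)%N => J j.+1
  | (i.+1, j.+1)%N => omega i.+1 j.+1
  end.

Fixpoint last_passage (R : realType) (omega : nat -> nat -> R) (I J : nat -> R)
    (m : nat) {struct m} : nat -> R :=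
  match m with
  | 0%N => fun n => \sum_(1 <= j < n.+1) J j
  | m'.+1 =>
      fix column (n : nat) : R :=
        match n with
        | 0%N => \sum_(1 <= i < m.+1) I i
        | n'.+1 => omega m n +
            Num.max (last_passage omega I J m' n) (column n')
        end
  end.

Definition stationary_lpp (d : measure_display) (T : measurableType d)
    (R : realType) (P : probability T R) (omega : nat -> nat -> {RV P >-> R})
    (I J : nat -> {RV P >-> R}) (m n : nat) : T -> R :=
  fun t => last_passage (fun i j => omega i j t) (I^~ t) (J^~ t) m n.

Section LastPassageRecursion.
Context {R : realType} (omega : nat -> nat -> R) (I J : nat -> R).
Local Notation G := (last_passage omega I J).

Lemma last_passage00 : G 0 0 = 0.
Proof. by rewrite /= big_geq. Qed.

Lemma last_passagem0 m : G m 0 = \sum_(1 <= i < m.+1) I i.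
Proof. by case: m => [|m] //=; rewrite !big_geq. Qed.

Lemma last_passage0n n : G 0 n = \sum_(1 <= j < n.+1) J j.
Proof. by []. Qed.

Lemma last_passageSS m n :
  G m.+1 n.+1 = omega m.+1 n.+1 + Num.max (G m n.+1) (G m.+1 n).
Proof. by []. Qed.

End LastPassageRecursion.

(* Main.v *)
(* For boundary rates 0 < al, be < 1 the last-passage value G^{al,be} satisfies
     E exp((al + be - 1) G^{al,be}(m, n)) = (be / (1-al))^n (al / (1-be))^m.
   Indeed G is the sum of the left column and of the increments along row [n];
   tilting the left column changes its rate from be to 1 - al, and for these
   stationary weights Burke's theorem makes the row increments iid Exp(al).
   Every pair of boundary rates is realised on the given probability space by
   scaling I and J.  A path leaves the origin along one axis only, so
   G(I, J) <= max(G(I, J'), G(I', J)), which bounds the upper exponential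
   moments of the stationary G on the scale N^{1/3}; convexity of G in its
   boundary weights then controls the lower tail, whence the upper bound on the
   variance.  For the lower bound, decreasing J to rate be > rho decreases G, and
   the positive cubic term of the log-moment generating function gives
   E exp(theta (G - E G)) >= 3 for theta = K N^{-1/3}; as exp z <= 1 + z exp z
   and E exp(2 theta (G - E G)) is bounded, AM-GM forces
   Var G >= c N^{2/3}.  Bounded N are handled by G >= omega_{m,n}. *)
Require Import Defs.
From HB Require Import structures.
From mathcomp Require Import all_boot all_order all_algebra finmap.
From mathcomp Require Import all_classical all_reals all_analysis.
From mathcomp Require Import measurable_realfun.
From mathcomp Require Import ring lra.
Set Implicit Arguments.
Unset Strict Implicit.
Unset Printing Implicit Defensive.
Import Order.TTheory GRing.Theory Num.Theory.
Local Open Scope classical_set_scope.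
Local Open Scope ring_scope.

(** * Measures with a density *)

(** On the stationary line [al + be = 1] the exact formula degenerates to E 1 = 1, so exponential
    moments of the stationary value can only be reached through models whose boundary rates are
    perturbed by some [u] and [v], with the exponent forced to be [u + v]. For |u|, |v| <= h the
    logarithm of the moment generating function is [(u + v) g + (v^2 - u^2)/2 * rate_gap + O(h^3
    N)], where [g = m/(1-rho) + n/rho]. The assumption on [kappa_N] makes [rate_gap] at most of
    order N^{2/3}; hence at h of order N^{-1/3} both error terms are bounded, which is the origin of
    the exponent. All estimates are centred at [g], and the true mean is only shown to lie within
    O(N^{1/3}) of it; the cubic gain K^3 in the lower bound therefore has to beat a linear term in K
    besides the quadratic one from [rate_gap]. Tilting is carried by a density [W] of total mass [c]
    on the given space: no second probability space appears, and Burke's theorem is applied under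
    the weighted measure. *)

Section weighted_measure.
Local Open Scope ereal_scope.
Context d (T : measurableType d) (R : realType).
Variables (mu : {measure set T -> \bar R}) (f : T -> R).

(** The proofs [f0] and [mf] travel inside the term, so that its measure structure can be inferred
    from the term alone. *)
Definition weighted_measure (f0 : forall x, (0 <= f x)%R)
    (mf : measurable_fun [set: T] f) (A : set T) : \bar R :=
  \int[mu]_(x in A) (f x)%:E.

Variables (f0 : forall x, (0 <= f x)%R) (mf : measurable_fun [set: T] f).
Local Notation nu := (weighted_measure f0 mf).

Let nu0 : nu set0 = 0.
Proof. by rewrite /weighted_measure integral_set0. Qed.

Let nu_ge0 A : 0 <= nu A.
Proof. by apply: integral_ge0 => x _; rewrite lee_fin. Qed.

Let nu_sigma_additive : semi_sigma_additive nu.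
Proof.
move=> /= F mF tF mUF; rewrite /weighted_measure; apply: cvg_toP.
  apply: ereal_nondecreasing_is_cvgn => m n mn.
  apply: lee_sum_nneg_natr => // k _ _; apply: integral_ge0 => x _.
  by rewrite lee_fin.
rewrite ge0_integral_bigcup//=; last by move=> x _; rewrite lee_fin.
by apply/measurable_EFinP; exact: measurable_funTS.
Qed.

HB.instance Definition _ := isMeasure.Build _ _ _ nu nu0 nu_ge0
  nu_sigma_additive.

Import HBNNSimple.

Let integral_weighted_nnsfun (h : {nnsfun T >-> R}) :
  \int[nu]_x (h x)%:E = \int[mu]_x ((h x)%:E * (f x)%:E).
Proof.
under [LHS]eq_integral do rewrite fimfunE -fsumEFin//.
rewrite [LHS]ge0_integral_fsum//; last 2 first.
  - by move=> r; exact/measurable_EFinP/measurableT_comp.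
  - by move=> n x _; rewrite EFinM nnfun_muleindic_ge0.
under [RHS]eq_integral.
  move=> x xD; rewrite fimfunE -fsumEFin// ge0_mule_fsuml; last first.
    by move=> r; rewrite EFinM nnfun_muleindic_ge0.
  over.
rewrite [RHS]ge0_integral_fsum//; last 2 first.
  - move=> r; apply: emeasurable_funM => //; apply/measurable_EFinP => //.
    by do 2 apply/measurableT_comp => //.
  - move=> n x _; apply: mule_ge0; last by rewrite lee_fin.
    by rewrite EFinM nnfun_muleindic_ge0.
apply: eq_fsbigr => r _; rewrite integralZl_indic_nnsfun//=.
have [r0|r0] := ltP r 0%R.
  rewrite preimage_nnfun0// integral_indic// set0I measure0 mule0.
  by rewrite integral0_eq// => x _; rewrite indic0 mulr0 mul0e.
rewrite integral_indic// setIT.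
under [RHS]eq_integral do rewrite EFinM -muleA.
rewrite ge0_integralZl//; last 2 first.
  - by apply: emeasurable_funM => //; exact/measurable_EFinP.
  - by move=> x _; rewrite mule_ge0// lee_fin.
congr (_ * _); transitivity (\int[mu]_(x in h @^-1` [set r]) (f x)%:E) => //.
rewrite integral_mkcond; apply: eq_integral => x _; rewrite patchE indicE.
by case: ifPn; rewrite ?mul1e ?mul0e.
Qed.

(** Linearity gives the identity for simple functions; monotone convergence along [nnsfun_approx],
    applied on both sides, gives the rest. *)
Lemma ge0_integral_weighted (g : T -> \bar R) : measurable_fun setT g ->
  (forall x, 0 <= g x) -> \int[nu]_x g x = \int[mu]_x (g x * (f x)%:E).
Proof.
move=> mg g0; pose g_ := nnsfun_approx measurableT mg.
have cvg_g x : EFin \o g_ ^~ x @ \oo --> g x by exact: cvg_nnsfun_approx.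
transitivity (limn (fun n => \int[nu]_x (g_ n x)%:E)).
  rewrite -monotone_convergence//=.
  - by apply: eq_integral => x _; apply/esym/cvg_lim => //; exact: cvg_g.
  - by move=> n; exact/measurable_EFinP/measurable_funP.
  - by move=> n y _; rewrite lee_fin.
  - by move=> y _ m n mn; rewrite lee_fin; exact/lefP/nd_nnsfun_approx.
under eq_fun do rewrite integral_weighted_nnsfun.
rewrite -monotone_convergence//=.
- apply: eq_integral => x _; apply/cvg_lim => //.
  by apply: cvgeZr => //; exact: cvg_g.
- move=> n; apply: emeasurable_funM => //; apply/measurable_EFinP => //.
- by move=> n y _; rewrite mule_ge0// lee_fin.
- move=> y _ m n mn; rewrite lee_wpmul2r// lee_fin//.
  exact/lefP/nd_nnsfun_approx.
Qed.

End weighted_measure.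

Section law_transfer.
Local Open Scope ereal_scope.
Context d1 d2 (T : measurableType d1) (S : measurableType d2) (R : realType).
Variables (mu : {measure set T -> \bar R}) (f : T -> R) (Z : T -> S).
Variables (pi : {measure set S -> \bar R}) (c : {nonneg R}).
Hypotheses (f0 : forall x, (0 <= f x)%R) (mf : measurable_fun [set: T] f).
Hypotheses (mZ : measurable_fun [set: T] Z).
Hypothesis lawZ : forall A, measurable A ->
  \int[mu]_(t in Z @^-1` A) (f t)%:E = c%:num%:E * pi A.

(** [lawZ] says that [Z] has law [c * pi] under the density [f]. The weighted measure pushed forward
    by [Z] then agrees with the scaled [pi] on measurable sets, hence in all nonnegative
    integrals. *)
Lemma ge0_integral_law (g : S -> \bar R) : measurable_fun setT g ->
  (forall x, 0 <= g x) ->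
  \int[mu]_t (g (Z t) * (f t)%:E) = c%:num%:E * \int[pi]_x g x.
Proof.
move=> mg g0; rewrite -(ge0_integral_weighted mu f0 mf (g := g \o Z))//.
  rewrite -[in LHS](preimage_setT Z) -ge0_integral_pushforward//.
  rewrite -ge0_integral_mscale//.
  by apply: eq_measure_integral => A mA _; exact: lawZ.
  exact: measurableT_comp.
by move=> x; exact: g0.
Qed.

End law_transfer.

(** * Joint laws determined by their values on rectangles *)

Section product_uniqueness.
Local Open Scope ereal_scope.
Context d1 d2 (T1 : measurableType d1) (T2 : measurableType d2)
  (R : realType).
Variables (m1 : {finite_measure set T1 -> \bar R})
  (m2 : {sigma_finite_measure set T2 -> \bar R}).

Lemma product_measure_scale_unique (c : {nonneg R})
    (m : {measure set (T1 * T2) -> \bar R}) :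
  (forall A B, measurable A -> measurable B ->
    m (A `*` B) = c%:num%:E * (m1 A * m2 B)) ->
  forall S, measurable S -> m S = c%:num%:E * (m1 \x m2) S.
Proof.
move=> mE S mS.
rewrite -(@product_measure_unique _ _ _ _ _ (mscale c m1) m2 m)//.
  rewrite /product_measure1 ge0_integral_mscale//.
  exact: measurable_fun_xsection.
by move=> A B mA mB; rewrite mE// /mscale muleA.
Qed.

End product_uniqueness.

(** With [A] frozen, the mass of [A] times a variable set is a measure on the last two factors,
    obtained by restriction and projection. The two-factor result applies to it with constant
    [c * m1 A]; a second application treats the first factor against the pair. *)
Lemma product3_measure_scale_unique d1 d2 d3 (T1 : measurableType d1)
    (T2 : measurableType d2) (T3 : measurableType d3) (R : realType)
    (m1 : {finite_measure set T1 -> \bar R})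
    (m2 : subprobability T2 R) (m3 : subprobability T3 R)
    (c : {nonneg R}) (m : {measure set (T1 * (T2 * T3)) -> \bar R}) :
  (forall A B C, measurable A -> measurable B -> measurable C ->
    m (A `*` (B `*` C)) = (c%:num%:E * (m1 A * (m2 B * m3 C)))%E) ->
  forall S, measurable S -> m S = (c%:num%:E * (m1 \x product_subprobability (m2, m3)) S)%E.
Proof.
move=> mE; refine (@product_measure_scale_unique _ _ T1 (T2 * T3)%type R m1
  (product_subprobability (m2, m3)) c m _).
move=> A S mA mS.
have mAT : measurable (A `*` [set: T2 * T3]) by exact: measurableX.
pose r : {measure set (T1 * (T2 * T3)) -> \bar R} := mrestr m mAT.
pose nu : {measure set (T2 * T3) -> \bar R} :=
  measure_function_pushforward__canonical__measure_function_Measure r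
    (@measurable_snd _ _ T1 (T2 * T3)%type).
have nuE S' : nu S' = m (A `*` S').
  rewrite /nu /= /pushforward /= /mrestr; congr (m _).
  by apply/seteqP; split => -[x y] /=; tauto.
have mA0 : 0 <= c%:num * fine (m1 A) by rewrite mulr_ge0// fine_ge0.
have cE : ((NngNum mA0)%:num)%:E = (c%:num%:E * m1 A)%E.
  by rewrite EFinM fineK ?fin_num_measure.
have nuR B C : measurable B -> measurable C ->
    nu (B `*` C) = ((NngNum mA0)%:num%:E * (m2 B * m3 C))%E.
  by move=> mB mC; rewrite nuE mE// cE muleA.
by rewrite -nuE (product_measure_scale_unique nuR mS) cE muleA.
Qed.

(** * Exponential laws *)

Section exponential.
Context (R : realType).
Implicit Types (r s c : R).
Local Notation mR := (measurableTypeR R).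

Lemma exponential_measure_subproof r (r0 : 0 < r) :
  {mu : probability mR R | forall A, mu A = exponential_prob r A}.
Proof.
have mu : {mu : probability mR R | mu = exponential_prob r :> (set mR -> \bar R)}.
  by unshelve eexists (exponential_prob r : probability mR R).
by exists (sval mu) => A; rewrite (svalP mu).
Qed.

(* Sealed, so that conversion never unfolds the density. *)
Definition exponential_measure r (r0 : 0 < r) : probability mR R :=
  sval (exponential_measure_subproof r0).

Lemma exponential_measureE r (r0 : 0 < r) A :
  exponential_measure r0 A = exponential_prob r A.
Proof. exact: svalP (exponential_measure_subproof r0) A. Qed.

Definition affine s c (x : mR) : mR := s * x + c.

Lemma measurable_affine s c : measurable_fun [set: mR] (affine s c).
Proof. by apply: measurable_funD => //; exact: measurable_funM. Qed.

(** The right-hand side is a measure in [A] that gives half-open intervals their length, and these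
    values determine Lebesgue measure. *)
Lemma lebesgue_measure_affine s c (A : set mR) : 0 < s -> measurable A ->
  lebesgue_measure A =
    (s%:E * lebesgue_measure (affine s c @^-1` A))%E.
Proof.
move=> s0 mA; pose ns : {nonneg R} := NngNum (ltW s0).
pose g := affine s c.
have mg : measurable_fun [set: mR] g by exact: measurable_affine.
pose m : {measure set mR -> \bar R} :=
  mscale ns (measure_function_pushforward__canonical__measure_function_Measure lebesgue_measure mg).
apply: (@lebesgue_measure_unique R m) => // _ [[a b] _ <-].
rewrite /m /= /mscale /= /pushforward.
have -> : g @^-1` `]a, b] = `](a - c) / s, (b - c) / s]%classic.
  apply/seteqP; split => x /=;
  by rewrite !in_itv/= /g /affine -ltrBlDr -lerBrDr ltr_pdivrMr// ler_pdivlMr// mulrC.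
rewrite !lebesgue_measure_itv/= !lte_fin ltr_pM2r ?invr_gt0// ltrD2r.
case: ifPn => _; last by rewrite mule0.
rewrite -!EFinB -EFinM; congr (_%:E).
by field; rewrite gt_eqF.
Qed.

Lemma ge0_integral_affine s c (phi : mR -> \bar R) : 0 < s ->
  measurable_fun [set: mR] phi -> (forall x, 0 <= phi x)%E ->
  (\int[lebesgue_measure]_x phi x =
   s%:E * \int[lebesgue_measure]_x phi (s * x + c)%R)%E.
Proof.
move=> s0 mphi phi0; pose ns : {nonneg R} := NngNum (ltW s0).
pose g := affine s c.
have mg : measurable_fun [set: mR] g by exact: measurable_affine.
rewrite (eq_measure_integral (mscale ns
  (measure_function_pushforward__canonical__measure_function_Measure
     lebesgue_measure mg))).
  rewrite ge0_integral_mscale//= ge0_integral_pushforward//.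
by move=> A mA _; exact: lebesgue_measure_affine.
Qed.

Lemma ge0_integral_exponential r (r0 : 0 < r) (phi : mR -> \bar R) :
  measurable_fun [set: mR] phi -> (forall x, 0 <= phi x)%E ->
  (\int[exponential_measure r0]_x phi x =
   \int[lebesgue_measure]_x (phi x * (exponential_pdf r x)%:E))%E.
Proof.
move=> mphi phi0.
have f0 x : 0 <= exponential_pdf r x by exact: exponential_pdf_ge0 (ltW r0) _.
rewrite -(ge0_integral_weighted lebesgue_measure f0
  (measurable_exponential_pdf r))//.
by apply: eq_measure_integral => A _ _; exact: exponential_measureE.
Qed.

Lemma exponential_pdf_tilt r th x : 0 < r -> th < r ->
  expR (th * x) * exponential_pdf r x =
  r / (r - th) * exponential_pdf (r - th) x.
Proof.
move=> r0 thr; have rth : r - th != 0 by rewrite gt_eqF// subr_gt0.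
have [x0|x0] := ltP x 0.
  by rewrite !lt0_exponential_pdf// !mulr0.
rewrite !exponential_pdfE// mulrCA -expRD -mulrDl addrC opprB.
by rewrite mulrA divfK// [- r + _]addrC.
Qed.

(** Multiplying [r exp(-r x)] by [exp(th x)] gives [r / (r - th)] times the density of rate
    [r - th]. The new rate is a separate [s] with an equation, so that it can be supplied in
    simplified form. *)
Lemma exponential_tilt r s th (r0 : 0 < r) (s0 : 0 < s)
    (phi : mR -> \bar R) : r - th = s ->
  measurable_fun [set: mR] phi -> (forall x, 0 <= phi x)%E ->
  (\int[exponential_measure r0]_x (phi x * (expR (th * x))%:E) =
   (r / s)%:E * \int[exponential_measure s0]_x phi x)%E.
Proof.
move=> rs; subst s; move=> mphi phi0; have thr : th < r by rewrite -subr_gt0.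
have me : measurable_fun [set: mR] (fun x : mR => (expR (th * x))%:E).
  by apply/measurable_EFinP; exact: (measurableT_comp (f := expR)).
have mp : measurable_fun [set: mR] (fun x : mR => (exponential_pdf (r - th) x)%:E).
  by apply/measurable_EFinP; exact: measurable_exponential_pdf.
have p0 x : (0 <= (exponential_pdf (r - th) x)%:E)%E.
  by rewrite lee_fin exponential_pdf_ge0// ltW.
rewrite !ge0_integral_exponential//; last 2 first.
- exact: emeasurable_funM.
- by move=> x; rewrite mule_ge0// lee_fin expR_ge0.
rewrite -ge0_integralZl//; last 3 first.
- exact: emeasurable_funM.
- by move=> x _; rewrite mule_ge0.
- by rewrite lee_fin divr_ge0// ltW.
apply: eq_integral => x _.
by rewrite -muleA -EFinM (exponential_pdf_tilt _ r0 thr) EFinM muleCA.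
Qed.

Lemma exponential_scale r s (r0 : 0 < r) (s0 : 0 < s) (A : set mR) :
  measurable A ->
  exponential_prob r (affine s 0 @^-1` A) =
  exponential_prob (r / s) A.
Proof.
move=> mA; have rs0 : 0 < r / s by exact: divr_gt0.
have mB : measurable (affine s 0 @^-1` A).
  by rewrite -[X in measurable X]setTI; exact: measurable_affine.
have mi (B : set mR) : measurable B ->
    measurable_fun [set: mR] (fun x : mR => (\1_B x)%:E : \bar R).
  by move=> mB'; exact/measurable_EFinP.
have i0 (B : set mR) x : (0 <= (\1_B x)%:E :> \bar R)%E by rewrite lee_fin.
have <- : (\int[exponential_measure r0]_x (\1_(affine s 0 @^-1` A) x)%:E =
    exponential_prob r (affine s 0 @^-1` A))%E.
  by rewrite integral_indic// setIT; exact: exponential_measureE.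
 rewrite (ge0_integral_exponential r0)//; last exact: mi.
have <- : (\int[exponential_measure rs0]_x (\1_A x)%:E =
    exponential_prob (r / s) A)%E.
  by rewrite integral_indic// setIT; exact: exponential_measureE.
rewrite (ge0_integral_exponential rs0 (mi _ mA) (i0 _)).
rewrite [RHS](@ge0_integral_affine s 0)//; last 2 first.
- apply: emeasurable_funM; first exact: mi.
  by apply/measurable_EFinP; exact: measurable_exponential_pdf.
- by move=> x; rewrite mule_ge0// lee_fin exponential_pdf_ge0// ltW.
rewrite -ge0_integralZl//; last 3 first.
- apply: emeasurable_funM.
    by apply: (measurableT_comp (mi _ mA)); exact: measurable_affine.
  apply/measurable_EFinP; apply: measurableT_comp.
    exact: measurable_exponential_pdf.
  exact: measurable_affine.
- by move=> x _; rewrite mule_ge0// lee_fin exponential_pdf_ge0// ltW.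
- by rewrite lee_fin ltW.
apply: eq_integral => x _; rewrite [RHS]muleCA -[in RHS]EFinM; congr (_ * _%:E)%E.
rewrite /affine addr0.
have [x0|x0] := ltP x 0.
  by rewrite !lt0_exponential_pdf ?mulr0// pmulr_rlt0.
rewrite !exponential_pdfE ?mulr_ge0 ?(ltW s0)//.
have -> : - (r / s) * (s * x) = - r * x by field; rewrite gt_eqF.
by field; rewrite gt_eqF.
Qed.

Lemma measurable_lteif d (T : measurableType d) (C : bool) (f g : T -> R) :
  measurable_fun [set: T] f -> measurable_fun [set: T] g ->
  measurable_fun [set: T] (fun t => (f t < g t ?<= if C)%:R%:E : \bar R).
Proof.
move=> mf mg; apply/measurable_EFinP; apply: (measurableT_comp
  (f := fun b : bool => b%:R : R)) => //.
by case: C => /=; [exact: measurable_fun_ler|exact: measurable_fun_ltr].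
Qed.

(** Memorylessness: translation by [y - w] carries the half-line above [w] to the one above [y] and
    multiplies the density by [exp(r w - r y)]; as [y] and [w] are nonnegative, both half-lines lie
    in the support. The flag [C] selects weak or strict inequality, so that the two orders of a pair
    can later partition the plane. *)
Lemma ge0_exponential_shift r (r0 : 0 < r) (C : bool) (phi : mR -> \bar R)
    (y w : R) :
  measurable_fun [set: mR] phi -> (forall x, 0 <= phi x)%E ->
  0 <= y -> 0 <= w ->
  (\int[exponential_measure r0]_x
      ((y < x ?<= if C)%:R%:E * phi (w + x - y)%R) =
   (expR (r * w - r * y))%:E *
    \int[exponential_measure r0]_x ((w < x ?<= if C)%:R%:E * phi x))%E.
Proof.
move=> mphi phi0 y0 w0.
have mp : measurable_fun [set: mR] (fun x : mR => (exponential_pdf r x)%:E).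
  by apply/measurable_EFinP; exact: measurable_exponential_pdf.
have p0 x : (0 <= (exponential_pdf r x)%:E)%E.
  by rewrite lee_fin exponential_pdf_ge0// ltW.
have l0 (u v : R) : (0 <= (u < v ?<= if C)%:R%:E :> \bar R)%E by rewrite lee_fin.
have mphi1 : measurable_fun [set: mR] (fun x : mR => phi (w + x - y)%R).
  apply: (measurableT_comp mphi).
  by apply: measurable_funB => //; exact: measurable_funD.
have mphi2 (z : R) : measurable_fun [set: mR]
    (fun x : mR => (z < x ?<= if C)%:R%:E : \bar R).
  exact: measurable_lteif.
rewrite !ge0_integral_exponential//; last 4 first.
- exact: emeasurable_funM.
- by move=> x; rewrite mule_ge0.
- exact: emeasurable_funM.
- by move=> x; rewrite mule_ge0.
pose F (x : mR) := ((y < x ?<= if C)%:R%:E * phi (w + x - y)%R *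
  (exponential_pdf r x)%:E)%E.
have mF : measurable_fun [set: mR] F.
  by apply: emeasurable_funM => //; exact: emeasurable_funM.
have F0 x : (0 <= F x)%E by rewrite /F !mule_ge0.
rewrite [LHS](ge0_integral_affine (y - w) ltr01 mF F0) mul1e.
rewrite -ge0_integralZl//; last 2 first.
- by apply: emeasurable_funM => //; exact: emeasurable_funM.
- by move=> x _; rewrite !mule_ge0.
rewrite /F; apply: eq_integral => x _; rewrite mul1r.
have -> : (y < x + (y - w) ?<= if C) = (w < x ?<= if C).
  by move: (C) => [] /=; apply/idP/idP; lra.
have -> : w + (x + (y - w)) - y = x by ring.
have [wx|_] := boolP (w < x ?<= if C); last by rewrite !mul0e mule0.
have {}wx : w <= x by exact: lteifW wx.
have x0 : 0 <= x by exact: le_trans wx.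
rewrite !mul1e muleCA -EFinM; congr (_ * _%:E)%E.
rewrite !exponential_pdfE//; last by rewrite addrA addrAC addr_ge0 ?subr_ge0.
rewrite mulrCA -expRD; congr (_ * expR _); ring.
Qed.

End exponential.

(** * Burke's property for one cell *)

Section burke.
Context (R : realType).
Local Notation mR := (measurableTypeR R).
Local Notation E r0 := (exponential_measure r0).

Lemma eq_exponential_integral (r : R) (r0 : 0 < r) (f g : mR -> \bar R) :
  measurable_fun [set: mR] f -> measurable_fun [set: mR] g ->
  (forall x, 0 <= f x)%E -> (forall x, 0 <= g x)%E ->
  (forall x, 0 <= x -> f x = g x) ->
  (\int[E r0]_x f x = \int[E r0]_x g x)%E.
Proof.
move=> mf mg f0 g0 fg.
rewrite (ge0_integral_exponential r0 mf f0) (ge0_integral_exponential r0 mg g0).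
apply: eq_integral => x _; have [x0|x0] := ltP x 0; last by rewrite fg.
by rewrite lt0_exponential_pdf// !mule0.
Qed.

(** The input is the increment along the bottom edge of a cell, the one along its left edge, and the
    weight of the upper right corner. The output is the increment along the top edge, the one along
    the right edge, and the dual weight of the reversed process. *)
Definition burke_map (z : mR * (mR * mR)) : mR * (mR * mR) :=
  (z.2.2 + Num.max (z.1 - z.2.1) 0,
    (z.2.2 + Num.max (z.2.1 - z.1) 0, Num.min z.1 z.2.1)).

Lemma measurable_burke_map : measurable_fun setT burke_map.
Proof.
have m1 : measurable_fun [set: mR * (mR * mR)] (fun z => z.1 : mR).
  exact: measurable_fst.
have m2 : measurable_fun [set: mR * (mR * mR)] (fun z => z.2.1 : mR).
  exact: (measurableT_comp measurable_fst measurable_snd).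
have m3 : measurable_fun [set: mR * (mR * mR)] (fun z => z.2.2 : mR).
  exact: (measurableT_comp measurable_snd measurable_snd).
apply: measurable_fun_pair => /=.
  apply: measurable_funD => //; apply: measurable_maxr => //.
  exact: measurable_funB.
apply: measurable_fun_pair => /=.
  apply: measurable_funD => //; apply: measurable_maxr => //.
  exact: measurable_funB.
exact: measurable_minr.
Qed.

Section half.
Context (a b c : R) (a0 : 0 < a) (b0 : 0 < b) (c0 : 0 < c) (C : bool).
Hypothesis ab : a + b = c.
Variables phi1 phi2 phi3 : mR -> \bar R.
Hypotheses (m1 : measurable_fun [set: mR] phi1)
  (m2 : measurable_fun [set: mR] phi2) (m3 : measurable_fun [set: mR] phi3).
Hypotheses (p1 : forall x, (0 <= phi1 x)%E) (p2 : forall x, (0 <= phi2 x)%E)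
  (p3 : forall x, (0 <= phi3 x)%E).

Let ltC (x y : R) : \bar R := (x < y ?<= if C)%:R%:E.

Let ltC0 x y : (0 <= ltC x y)%E. Proof. by rewrite lee_fin. Qed.

(** Where [y] is below [x], [burke_map] sends [(x, (y, w))] to [(w + x - y, (w, y))]; this is a
    product test function composed with the map on that region. *)
Definition burke_half_fun (z : mR * (mR * mR)) : \bar R :=
  (ltC z.2.1 z.1 * phi1 (z.2.2 + z.1 - z.2.1)%R * (phi2 z.2.2 * phi3 z.2.1))%E.

Lemma burke_half_fun_ge0 z : (0 <= burke_half_fun z)%E.
Proof. by rewrite /burke_half_fun !mule_ge0. Qed.

Lemma measurable_burke_half_fun : measurable_fun setT burke_half_fun.
Proof.
have f1 : measurable_fun [set: mR * (mR * mR)] (fun z => z.1 : mR).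
  exact: measurable_fst.
have f2 : measurable_fun [set: mR * (mR * mR)] (fun z => z.2.1 : mR).
  exact: (measurableT_comp measurable_fst measurable_snd).
have f3 : measurable_fun [set: mR * (mR * mR)] (fun z => z.2.2 : mR).
  exact: (measurableT_comp measurable_snd measurable_snd).
apply: emeasurable_funM; apply: emeasurable_funM.
- exact: measurable_lteif.
- apply: (measurableT_comp m1); apply: measurable_funB => //.
  exact: measurable_funD.
- exact: (measurableT_comp m2).
- exact: (measurableT_comp m3).
Qed.

Let G (w : mR) : \bar R := (\int[E a0]_x (ltC w x * phi1 x))%E.

Let mlt : measurable_fun [set: mR * mR] (fun z : mR * mR => ltC z.1 z.2 * phi1 z.2)%E.
Proof.
apply: emeasurable_funM; first exact: measurable_lteif.
exact: (measurableT_comp m1).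
Qed.

Let mG : measurable_fun [set: mR] G.
Proof.
apply: (measurable_fun_fubini_tonelli_F (m2 := E a0)
  (fun z : mR * mR => ltC z.1 z.2 * phi1 z.2)%E) => // z.
by rewrite mule_ge0.
Qed.

Let G0 w : (0 <= G w)%E.
Proof. by apply: integral_ge0 => x _; rewrite mule_ge0. Qed.

Let e0 (k x : R) : (0 <= (expR (k * x))%:E)%E.
Proof. by rewrite lee_fin expR_ge0. Qed.

Let mexp (k : R) : measurable_fun [set: mR] (fun x : mR => (expR (k * x))%:E).
Proof. by apply/measurable_EFinP; exact: (measurableT_comp (f := expR)). Qed.

Let H (p : mR * mR) : \bar R := (\int[E a0]_x burke_half_fun (x, p))%E.

Let mH : measurable_fun [set: mR * mR] H.
Proof.
apply: (measurable_fun_fubini_tonelli_G (m1 := E a0) burke_half_fun).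
  exact: measurable_burke_half_fun.
exact: burke_half_fun_ge0.
Qed.

Let H0 p : (0 <= H p)%E.
Proof. by apply: integral_ge0 => x _; exact: burke_half_fun_ge0. Qed.

Let k2 (w : mR) : \bar R := (phi2 w * G w * (expR (a * w))%:E)%E.
Let k3 (y : mR) : \bar R := (phi3 y * (expR (- a * y))%:E)%E.

Let mphi2 : measurable_fun [set: mR] (fun w => phi2 w * G w)%E.
Proof. by apply: emeasurable_funM; [exact: m2|exact: mG]. Qed.

Let phi20 w : (0 <= phi2 w * G w)%E.
Proof. exact: mule_ge0 (p2 w) (G0 w). Qed.

Let mk2 : measurable_fun [set: mR] k2.
Proof. by apply: emeasurable_funM; [exact: mphi2|exact: mexp]. Qed.

Let mk3 : measurable_fun [set: mR] k3.
Proof. by apply: emeasurable_funM; [exact: m3|exact: mexp]. Qed.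

Let k20 w : (0 <= k2 w)%E.
Proof. exact: mule_ge0 (phi20 w) (e0 a w). Qed.

Let k30 w : (0 <= k3 w)%E.
Proof. exact: mule_ge0 (p3 w) (e0 (- a) w). Qed.

(* Both coordinates [y] and [w] are nonnegative almost surely, which is where
   the memoryless property applies. *)
Let HE y w : 0 <= y -> 0 <= w -> H (y, w) = (k3 y * k2 w)%E.
Proof.
move=> y0 w0; transitivity
  ((\int[E a0]_x (ltC y x * phi1 (w + x - y)%R)) * (phi2 w * phi3 y))%E.
  have mphi1 : measurable_fun [set: mR]
      (fun x : mR => ltC y x * phi1 (w + x - y)%R)%E.
    apply: emeasurable_funM; first exact: measurable_lteif.
    apply: (measurableT_comp m1); apply: measurable_funB => //.
    exact: measurable_funD.
  have k0 : (0 <= phi2 w * phi3 y)%E by exact: mule_ge0.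
  have f0 x : [set: mR] x -> (0 <= ltC y x * phi1 (w + x - y)%R)%E.
    by move=> _; exact: mule_ge0.
  exact: (ge0_integralZr (E a0) measurableT mphi1 f0 k0).
rewrite (ge0_exponential_shift a0 C m1 p1 y0 w0) expRD -mulNr EFinM -/(G w).
by rewrite (AC (3*2) ((5*2)*(4*3*1))).
Qed.

Let K : \bar R := (\int[E c0]_w k2 w)%E.

Let K0 : (0 <= K)%E.
Proof. by apply: integral_ge0 => w _; exact: k20. Qed.

Let intH y : 0 <= y -> (\int[E c0]_w H (y, w) = k3 y * K)%E.
Proof.
move=> y0; transitivity (\int[E c0]_w (k3 y * k2 w))%E.
  apply: eq_exponential_integral.
  - by have := measurable_fun_pair2 y mH; exact.
  - by apply: emeasurable_funM; [exact: measurable_cst|exact: mk2].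
  - by move=> w; exact: H0.
  - by move=> w; exact: mule_ge0 (k30 y) (k20 w).
  - by move=> w w0; exact: HE.
exact: (ge0_integralZl (E c0) measurableT mk2 (fun w _ => k20 w) (k30 y)).
Qed.

Let intintH : (\int[E b0]_y \int[E c0]_w H (y, w) = (\int[E b0]_y k3 y) * K)%E.
Proof.
transitivity (\int[E b0]_y (k3 y * K))%E.
  apply: eq_exponential_integral.
  - exact: (measurable_fun_fubini_tonelli_F (m2 := E c0) H mH H0).
  - by apply: emeasurable_funM; [exact: mk3|exact: measurable_cst].
  - by move=> y; apply: integral_ge0 => w _; exact: H0.
  - by move=> y; exact: mule_ge0 (k30 y) K0.
  - exact: intH.
exact: (ge0_integralZr (E b0) measurableT mk3 (fun w _ => k30 w) K0).
Qed.

Let int_k3 : (\int[E b0]_y k3 y = (b / c)%:E * \int[E c0]_x phi3 x)%E.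
Proof. by apply: (exponential_tilt b0 c0 _ m3 p3); rewrite opprK addrC. Qed.

Let KE : (K = (c / b)%:E * \int[E b0]_w (phi2 w * G w))%E.
Proof.
by apply: (exponential_tilt c0 b0 _ mphi2 phi20); rewrite -ab addrC addKr.
Qed.

(** Integrating out [x] by memorylessness leaves a function of [y] carrying [exp(-a y)] times a
    function of [w] carrying [exp(a w)]. Since [a + b = c], these tilts exchange the two rates: [y]
    passes from [b] to [c] and [w] from [c] to [b]. The normalisations [b / c] and [c / b]
    cancel. *)
Lemma burke_half :
  (\int[E b0]_y \int[E c0]_w \int[E a0]_x burke_half_fun (x, (y, w)) =
   (\int[E c0]_x phi3 x) *
     \int[E b0]_w (phi2 w * \int[E a0]_x (ltC w x * phi1 x)))%E.
Proof.
have alg (u v : R) (X Y : \bar R) : u * v = 1 ->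
    (u%:E * X * (v%:E * Y) = X * Y)%E.
  by move=> uv; rewrite muleACA -EFinM uv mul1e.
apply: (etrans intintH); apply: (etrans (congr2 mule int_k3 KE)).
by apply: alg; rewrite mulrA divfK ?divff ?gt_eqF.
Qed.

End half.

(** The cases [y <= x] and [x < y]. The second is the first with the two increments exchanged, and
    with them [A1] and [A2]; ties belong to the first. *)
Lemma indic_burke_map (A1 A2 A3 : set mR) (x y w : mR) :
  ((\1_(burke_map @^-1` (A1 `*` (A2 `*` A3))) (x, (y, w)) : R)%:E =
   burke_half_fun true (fun x => (\1_A1 x)%:E) (fun x => (\1_A2 x)%:E)
     (fun x => (\1_A3 x)%:E) (x, (y, w)) +
   burke_half_fun false (fun x => (\1_A2 x)%:E) (fun x => (\1_A1 x)%:E)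
     (fun x => (\1_A3 x)%:E) (y, (x, w)))%E.
Proof.
have indicX (u v t : mR) : (\1_(A1 `*` (A2 `*` A3)) (u, (v, t)) : R) =
    \1_A1 u * (\1_A2 v * \1_A3 t).
  rewrite !indicE -!natrM !mulnb; congr (nat_of_bool _)%:R.
  apply/idP/idP; rewrite !inE /=.
    by move=> [h1 [h2 h3]]; rewrite !mem_set.
  by move=> /and3P[]; rewrite !inE.
transitivity ((\1_(A1 `*` (A2 `*` A3)) (burke_map (x, (y, w))) : R)%:E) => //.
rewrite /burke_map/= indicX /burke_half_fun/= -!EFinM -EFinD; congr _%:E.
have [yx|xy] := leP y x.
  rewrite (max_l _) ?subr_ge0// (max_r _) ?subr_le0// addr0 addrA.
  by rewrite mul1r !mul0r addr0.
rewrite (max_r _) ?subr_le0 ?(ltW xy)// (max_l _) ?subr_ge0 ?(ltW xy)// addr0.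
by rewrite mul1r !mul0r add0r addrA mulrCA.
Qed.

Lemma integral_indicT d (T : measurableType d) (mu : {measure set T -> \bar R})
    (A : set T) : measurable A -> (\int[mu]_x (\1_A x)%:E = mu A)%E.
Proof.
by move=> mA; have := integral_indic mu measurableT mA; rewrite setIT.
Qed.

(** Weak inequality in one term and strict inequality in the other partition the plane, so that
    together the two terms integrate the product of the indicators without restriction. *)
Lemma order_split (a b : R) (a0 : 0 < a) (b0 : 0 < b) (A1 A2 : set mR) :
  measurable A1 -> measurable A2 ->
  (\int[E b0]_w ((\1_A2 w)%:E *
      \int[E a0]_x ((w < x ?<= if true)%:R%:E * (\1_A1 x)%:E)) +
   \int[E a0]_w ((\1_A1 w)%:E *
      \int[E b0]_x ((w < x ?<= if false)%:R%:E * (\1_A2 x)%:E)) =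
   E a0 A1 * E b0 A2)%E.
Proof.
move=> mA1 mA2.
have mi d (T : measurableType d) (B : set mR) (f : T -> mR) : measurable B ->
    measurable_fun [set: T] f ->
    measurable_fun [set: T] (fun x => (\1_B (f x))%:E : \bar R).
  move=> mB mf; apply/measurable_EFinP.
  exact: (measurableT_comp (f := \1_B : mR -> R)).
have i0 (B : set mR) x : (0 <= (\1_B x)%:E :> \bar R)%E by rewrite lee_fin.
have l0 (x y : R) C : (0 <= (x < y ?<= if C)%:R%:E :> \bar R)%E by rewrite lee_fin.
have ml (A : set mR) (w : mR) C : measurable A -> measurable_fun [set: mR]
    (fun x : mR => (w < x ?<= if C)%:R%:E * (\1_A x)%:E : \bar R)%E.
  move=> mA; apply: emeasurable_funM; first exact: measurable_lteif.
  exact: mi.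
pose q1 (z : mR * mR) : \bar R :=
  ((\1_A2 z.2)%:E * ((z.2 < z.1 ?<= if true)%:R%:E * (\1_A1 z.1)%:E))%E.
pose q2 (z : mR * mR) : \bar R :=
  ((\1_A1 z.1)%:E * ((z.1 < z.2 ?<= if false)%:R%:E * (\1_A2 z.2)%:E))%E.
have mq1 : measurable_fun setT q1.
  apply: emeasurable_funM; first by apply: mi => //; exact: measurable_snd.
  apply: emeasurable_funM; last by apply: mi => //; exact: measurable_fst.
  by apply: measurable_lteif; [exact: measurable_snd|exact: measurable_fst].
have mq2 : measurable_fun setT q2.
  apply: emeasurable_funM; first by apply: mi => //; exact: measurable_fst.
  apply: emeasurable_funM; last by apply: mi => //; exact: measurable_snd.
  by apply: measurable_lteif; [exact: measurable_fst|exact: measurable_snd].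
have q10 z : (0 <= q1 z)%E by apply: mule_ge0 => //; exact: mule_ge0.
have q20 z : (0 <= q2 z)%E by apply: mule_ge0 => //; exact: mule_ge0.
have X1 : (\int[E b0]_w ((\1_A2 w)%:E *
    \int[E a0]_x ((w < x ?<= if true)%:R%:E * (\1_A1 x)%:E)) =
    \int[E b0]_w \int[E a0]_x q1 (x, w))%E.
  apply: eq_integral => w _; apply: esym.
  apply: (ge0_integralZl (E a0) measurableT _ _ (i0 A2 w)).
  - exact: ml.
  - by move=> x _; exact: mule_ge0.
have X2 : (\int[E a0]_w ((\1_A1 w)%:E *
    \int[E b0]_x ((w < x ?<= if false)%:R%:E * (\1_A2 x)%:E)) =
    \int[E b0]_w \int[E a0]_x q2 (x, w))%E.
  transitivity (\int[E a0]_x \int[E b0]_w q2 (x, w))%E; last first.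
    exact: (fubini_tonelli q2 mq2 q20).
  apply: eq_integral => w _; apply: esym.
  apply: (ge0_integralZl (E b0) measurableT _ _ (i0 A1 w)).
  - exact: ml.
  - by move=> x _; exact: mule_ge0.
apply: (etrans (congr2 +%E X1 X2)).
rewrite -(ge0_integralD _ measurableT); last 4 first.
- by move=> w _; exact: integral_ge0.
- exact: (measurable_fun_fubini_tonelli_G (m1 := E a0) q1 mq1 q10).
- by move=> w _; exact: integral_ge0.
- exact: (measurable_fun_fubini_tonelli_G (m1 := E a0) q2 mq2 q20).
transitivity (\int[E b0]_w (E a0 A1 * (\1_A2 w)%:E))%E; last first.
  have mi2 := mi _ _ _ idfun mA2 (@measurable_id _ _ _).
  have iE : (\int[E b0]_w (\1_A2 w)%:E = E b0 A2)%E.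
    exact: integral_indicT.
  apply: (etrans (ge0_integralZl (E b0) measurableT mi2 (fun w _ => i0 A2 w)
    (measure_ge0 _ _))).
  by rewrite iE.
apply: eq_integral => w _.
rewrite -(ge0_integralD _ measurableT); last 4 first.
- by move=> x _; exact: q10.
- by have := measurable_fun_pair1 w mq1; exact.
- by move=> x _; exact: q20.
- by have := measurable_fun_pair1 w mq2; exact.
transitivity (\int[E a0]_x ((\1_A1 x)%:E * (\1_A2 w)%:E))%E; last first.
  have mi1 := mi _ _ _ idfun mA1 (@measurable_id _ _ _).
  have iE : (\int[E a0]_x (\1_A1 x)%:E = E a0 A1)%E.
    exact: integral_indicT.
  apply: (etrans (ge0_integralZr (E a0) measurableT mi1 (fun w _ => i0 A1 w)
    (i0 A2 w))).
  by rewrite iE.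
apply: eq_integral => x _; rewrite /q1 /q2/= -!EFinM -EFinD; congr _%:E.
move: (\1_A2 w : R) (\1_A1 x : R) => u v.
by have [wx|xw] := leP w x => /=; ring.
Qed.

(** By [burke_half] either order of the increments contributes the same factor, the law of the
    minimum at rate [c], times the share of that order in the law of the remaining pair;
    [order_split] adds up the two shares. *)
Theorem burke (a b c : R) (a0 : 0 < a) (b0 : 0 < b) (c0 : 0 < c)
    (A1 A2 A3 : set mR) :
  a + b = c -> measurable A1 -> measurable A2 -> measurable A3 ->
  (E a0 \x product_subprobability (E b0 : subprobability _ _,
                                   E c0 : subprobability _ _))%E
    (burke_map @^-1` (A1 `*` (A2 `*` A3))) =
  (E a0 A1 * (E b0 A2 * E c0 A3))%E.
Proof.
move=> ab mA1 mA2 mA3.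
set pi := product_subprobability _.
have mi (B : set mR) : measurable B ->
    measurable_fun [set: mR] (fun x : mR => (\1_B x)%:E : \bar R).
  by move=> mB'; exact/measurable_EFinP.
have i0 (B : set mR) x : (0 <= (\1_B x)%:E :> \bar R)%E by rewrite lee_fin.
have mS : measurable (burke_map @^-1` (A1 `*` (A2 `*` A3))).
  rewrite -[X in measurable X]setTI; apply: measurable_burke_map => //.
  by apply: measurableX => //; exact: measurableX.
pose f1 : mR * (mR * mR) -> \bar R := burke_half_fun true
  (fun x => (\1_A1 x)%:E) (fun x => (\1_A2 x)%:E) (fun x => (\1_A3 x)%:E).
pose g2 : mR * (mR * mR) -> \bar R := burke_half_fun false
  (fun x => (\1_A2 x)%:E) (fun x => (\1_A1 x)%:E) (fun x => (\1_A3 x)%:E).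
pose f2 (z : mR * (mR * mR)) : \bar R := g2 (z.2.1, (z.1, z.2.2)).
have mf1 : measurable_fun setT f1 by apply: measurable_burke_half_fun; exact: mi.
have mg2 : measurable_fun setT g2 by apply: measurable_burke_half_fun; exact: mi.
have mf2 : measurable_fun setT f2.
  apply: (measurableT_comp mg2); apply: measurable_fun_pair.
    exact: (measurableT_comp measurable_fst measurable_snd).
  apply: measurable_fun_pair; first exact: measurable_fst.
  exact: (measurableT_comp measurable_snd measurable_snd).
have f10 z : (0 <= f1 z)%E by apply: burke_half_fun_ge0.
have g20 z : (0 <= g2 z)%E by apply: burke_half_fun_ge0.
have f20 z : (0 <= f2 z)%E by exact: g20.
apply: (etrans (esym (integral_indicT (E a0 \x pi)%E mS))).
transitivity (\int[E a0 \x pi]_z (f1 z + f2 z))%E.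
  by apply: eq_integral => -[x [y w]] _; exact: indic_burke_map.
rewrite (ge0_integralD _ measurableT (fun z _ => f10 z) mf1 (fun z _ => f20 z) mf2).
have piE (g : mR * mR -> \bar R) :
    (\int[pi]_p g p = \int[E b0 \x E c0]_p g p)%E.
  by apply: eq_measure_integral.
have I1 : (\int[E a0 \x pi]_z f1 z =
    \int[E b0]_y \int[E c0]_w \int[E a0]_x f1 (x, (y, w)))%E.
  rewrite (fubini_tonelli1 f1 mf1 f10).
  transitivity (\int[pi]_p \int[E a0]_x f1 (x, p))%E.
    exact: (fubini_tonelli f1 mf1 f10).
  rewrite piE (fubini_tonelli1 (fun p => \int[E a0]_x f1 (x, p))%E)//.
  - exact: (measurable_fun_fubini_tonelli_G (m1 := E a0) f1 mf1 f10).
  - by move=> p; apply: integral_ge0.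
have I2 : (\int[E a0 \x pi]_z f2 z =
    \int[E a0]_x \int[E c0]_w \int[E b0]_y g2 (y, (x, w)))%E.
  rewrite (fubini_tonelli1 f2 mf2 f20); apply: eq_integral => x _.
  rewrite /fubini_F piE.
  have mf2x : measurable_fun setT (fun p => f2 (x, p)).
    by have := measurable_fun_pair2 x mf2; exact.
  rewrite (fubini_tonelli1 (fun p => f2 (x, p)) mf2x (fun p => f20 (x, p))).
  exact: (fubini_tonelli (fun p => f2 (x, p)) mf2x (fun p => f20 (x, p))).
have H1 := burke_half a0 b0 c0 true ab (mi _ mA1) (mi _ mA2) (mi _ mA3)
  (i0 _) (i0 _) (i0 _).
have ba : b + a = c by rewrite addrC.
have H2 := burke_half b0 a0 c0 false ba (mi _ mA2) (mi _ mA1) (mi _ mA3)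
  (i0 _) (i0 _) (i0 _).
apply: (etrans (congr2 +%E (etrans I1 H1) (etrans I2 H2))).
rewrite -ge0_muleDr; last 2 first.
- by apply: integral_ge0 => w _; apply: mule_ge0 => //; exact: integral_ge0.
- by apply: integral_ge0 => w _; apply: mule_ge0 => //; exact: integral_ge0.
apply: (etrans (congr2 *%E (integral_indicT (E c0) mA3)
  (order_split a0 b0 mA1 mA2))).
by rewrite muleC muleA.
Qed.
End burke.

(** * Independent exponential families under a density *)

Section independent_exponentials.
Context d (T : measurableType d) (R : realType) (P : probability T R).
Context (K : choiceType).
Local Notation mR := (measurableTypeR R).
Implicit Types (W : T -> R) (c : R) (s : seq K) (X : K -> T -> mR) (r : K -> R).
Implicit Types (A : K -> set mR).

Definition cylinder s X A : set T :=
  [set t | forall k, k \in s -> A k (X k t)].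

(** Real-valued, so that products over finitely many indices stay in [R]. *)
Definition exponential_weight (q : R) (B : set mR) : R :=
  fine (exponential_prob q B).

Lemma exponential_weightE (q : R) (q0 : 0 < q) B :
  measurable B -> (exponential_weight q B)%:E = exponential_measure q0 B.
Proof.
move=> mB; rewrite /exponential_weight -(exponential_measureE q0).
by apply: fineK; exact: fin_num_measure.
Qed.

Lemma exponential_weight_ge0 (q : R) B : 0 < q -> 0 <= exponential_weight q B.
Proof.
move=> q0; rewrite /exponential_weight fine_ge0//.
by rewrite -(exponential_measureE q0); exact: measure_ge0.
Qed.

Lemma exponential_weightT (q : R) : 0 < q -> exponential_weight q setT = 1.
Proof.
move=> q0; rewrite /exponential_weight -(exponential_measureE q0).
have -> : exponential_measure q0 setT = 1%E by exact: probability_setT.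
by [].
Qed.

Lemma exponential_tilt_indic (q th : R) (q0 : 0 < q) B :
  th < q -> measurable B ->
  (\int[exponential_measure q0]_x ((\1_B x)%:E * (expR (th * x))%:E) =
   (q / (q - th) * exponential_weight (q - th) B)%:E)%E.
Proof.
move=> thq mB; have qth0 : 0 < q - th by rewrite subr_gt0.
have mi : measurable_fun [set: mR] (fun x : mR => (\1_B x)%:E : \bar R).
  by apply/measurable_EFinP; exact: measurable_indic.
have i0 x : (0 <= (\1_B x)%:E :> \bar R)%E by rewrite lee_fin.
apply: (etrans (exponential_tilt q0 qth0 erefl mi i0)); rewrite [RHS]EFinM.
apply: (congr2 *%E (erefl _)).
apply: (etrans (integral_indicT _ mB)); apply: esym.
exact: exponential_weightE.
Qed.

(* Under the finite measure with density [W] and total mass [c], the variables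
   [X k] with [k \in s] are independent and exponential with rates [r k]. *)
Record independent_exponentials W c s X r : Prop := IndependentExponentials {
  ie_weight_ge0 : forall t, 0 <= W t ;
  ie_weight_measurable : measurable_fun setT W ;
  ie_var_measurable : forall k, measurable_fun setT (X k) ;
  ie_mass_ge0 : 0 <= c ;
  ie_rate_gt0 : forall k, 0 < r k ;
  ie_law : forall A, (forall k, measurable (A k)) ->
    (\int[P]_(t in cylinder s X A) (W t)%:E =
     (c * \prod_(k <- s) exponential_weight (r k) (A k))%:E)%E }.

Lemma measurable_cylinder s X A : (forall k, measurable_fun setT (X k)) ->
  (forall k, measurable (A k)) -> measurable (cylinder s X A).
Proof.
move=> mX mA; elim: s => [|k s IHs].
  by rewrite (_ : cylinder _ _ _ = setT)//; apply/seteqP; split.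
rewrite (_ : cylinder _ _ _ = X k @^-1` A k `&` cylinder s X A).
  apply: measurableI => //; rewrite -[X in measurable X]setTI; exact: mX.
apply/seteqP; split => t /=.
  move=> h; split; first by apply: h; rewrite mem_head.
  by move=> j js; apply: h; rewrite in_cons js orbT.
by move=> [h1 h2] j; rewrite in_cons => /predU1P[->//|]; exact: h2.
Qed.

Lemma independent_exponentials_perm W c s s' X r : perm_eq s s' ->
  independent_exponentials W c s X r -> independent_exponentials W c s' X r.
Proof.
move=> ss' [W0 mW mX c0 r0 law]; split => // A mA.
rewrite -(perm_big _ ss')/= -law//; congr (integral _ _ _).
by apply/seteqP; split => t h k ks; apply: h; rewrite ?(perm_mem ss')// -(perm_mem ss').
Qed.

Lemma integral_mul_indic W (D E : set T) :
  (\int[P]_(t in D) (W t * \1_E t)%:E = \int[P]_(t in D `&` E) (W t)%:E)%E.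
Proof.
rewrite integral_mkcondr; apply: eq_integral => t _; rewrite patchE indicE.
by case: ifPn => _; rewrite ?mulr1// mulr0.
Qed.

Lemma measurable_mul_indic W (E : set T) : measurable_fun setT W ->
  measurable E -> measurable_fun setT (fun t => W t * \1_E t).
Proof. by move=> mW mE; exact: measurable_funM. Qed.

(** The cylinder event of the indices in [s] is absorbed into the density. Under [W * \1_E] the
    variable [X k] alone then has a multiple of an exponential law, and the one-variable tilt
    applies. *)
Lemma independent_exponentials_tilt_head W c k s X r th :
  uniq (k :: s) -> th < r k ->
  independent_exponentials W c (k :: s) X r ->
  independent_exponentials (fun t => W t * expR (th * X k t))
    (c * (r k / (r k - th))) (k :: s) X
    (fun j => if j == k then r j - th else r j).
Proof.
move=> /= /andP[kns us] thr [W0 mW mX c0 r0 law].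
have rth0 : 0 < r k - th by rewrite subr_gt0.
split.
- by move=> t; rewrite mulr_ge0 ?expR_ge0.
- apply: measurable_funM => //; apply: (measurableT_comp (f := expR)) => //.
  by apply: measurable_funM; [exact: measurable_cst|exact: mX].
- exact: mX.
- by rewrite mulr_ge0// divr_ge0// ltW.
- by move=> j; case: eqP => // ->.
move=> A mA.
pose E := cylinder s X A.
have mE : measurable E by exact: measurable_cylinder.
pose p := \prod_(j <- s) exponential_weight (r j) (A j).
have p0 : 0 <= c * p.
  by rewrite mulr_ge0// prodr_ge0// => j _; exact: exponential_weight_ge0.
have law' B : measurable B ->
    (\int[P]_(t in X k @^-1` B) (W t * \1_E t)%:E =
     (NngNum p0)%:num%:E * exponential_measure (r0 k) B)%E.
  move=> mB; rewrite integral_mul_indic.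
  have := law (fun j => if j == k then B else A j).
  rewrite big_cons eqxx -(exponential_weightE (r0 k) mB) -EFinM /=.
  rewrite (_ : \prod_(j <- s) _ = p); last first.
    apply: eq_big_seq => j js; rewrite ifF//.
    by apply: contraNF kns => /eqP <-.
  rewrite [c * (_ * _)]mulrCA mulrC => <-; last by move=> j; case: ifP.
  congr (integral _ _ _); apply/seteqP; split => t /=.
    move=> [h1 h2] j; rewrite in_cons; case: eqP => [->//|_ /= js].
    exact: h2.
  move=> h; split; first by have := h k; rewrite mem_head eqxx; exact.
  move=> j js; have := h j; rewrite in_cons js orbT ifF; first exact.
  by apply: contraNF kns => /eqP <-.
have WE0 t : 0 <= W t * \1_E t by rewrite mulr_ge0.
have mWE := measurable_mul_indic mW mE.
pose g (x : mR) : \bar R := ((\1_(A k) x)%:E * (expR (th * x))%:E)%E.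
have mi : measurable_fun [set: mR] (fun x : mR => (\1_(A k) x)%:E : \bar R).
  by apply/measurable_EFinP; exact: measurable_indic.
have mg : measurable_fun setT g.
  apply: emeasurable_funM => //.
  by apply/measurable_EFinP; exact: (measurableT_comp (f := expR)).
have g0 x : (0 <= g x)%E by rewrite mule_ge0 ?lee_fin// expR_ge0.
have key : (\int[P]_t (g (X k t) * (W t * \1_E t)%:E) = (c * p *
    (r k / (r k - th) * exponential_weight (r k - th) (A k)))%:E)%E.
  apply: (etrans (ge0_integral_law WE0 mWE (mX k) law' mg g0)).
  rewrite [RHS]EFinM; apply: (congr2 *%E (erefl _)).
  exact: exponential_tilt_indic.
rewrite big_cons eqxx (_ : \prod_(j <- s) _ = p); last first.
  apply: eq_big_seq => j js; rewrite ifF//.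
  by apply: contraNF kns => /eqP <-.
rewrite (_ : c * (r k / (r k - th)) * _ = c * p *
    (r k / (r k - th) * exponential_weight (r k - th) (A k))); last by ring.
rewrite -key [LHS]integral_mkcond; apply: eq_integral => t _.
rewrite patchE /g !indicE.
have -> : (t \in cylinder (k :: s) X A) = (X k t \in A k) && (t \in E).
  apply/idP/idP.
    rewrite inE => h; apply/andP; split; rewrite inE.
      by apply: h; rewrite mem_head.
    by move=> j js; apply: h; rewrite in_cons js orbT.
  case/andP; rewrite !inE => h1 h2 j; rewrite in_cons => /predU1P[->//|].
  exact: h2.
case: (X k t \in A k) => /=; last by rewrite mul0e mul0e.
case: (t \in E) => /=; last by rewrite mulr0 mule0.
by rewrite mul1e mulr1 mulrC.
Qed.

(** [burke_map] acting in place: the slots [h] and [v] pass from the bottom and left edges of a cell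
    to its top and right edges, and [o] receives the dual weight. *)
Definition burke_step (h v o : K) (x : K -> mR) (k : K) : mR :=
  if k == h then x o + Num.max (x h - x v) 0
  else if k == v then x o + Num.max (x v - x h) 0
  else if k == o then Num.min (x h) (x v)
  else x k.

Let prod3_rearrange (c p x y z : R) :
  (c * (x * (y * (z * p))))%:E = ((c * p)%:E * (x%:E * (y%:E * z%:E)))%E.
Proof. by rewrite -!EFinM; congr EFin; ring. Qed.

(** The events of the other indices are again absorbed into the density. The law of the triple is
    then a multiple of a product measure, being so on rectangles, and [burke] shows that this
    measure is preserved by the step. *)
Lemma independent_exponentials_burke_head W c h v o s X r :
  uniq [:: h, v, o & s] -> r h + r v = r o ->
  independent_exponentials W c [:: h, v, o & s] X r ->
  independent_exponentials W c [:: h, v, o & s]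
    (fun k t => burke_step h v o (X ^~ t) k) r.
Proof.
move=> us rhv [W0 mW mX c0 r0 law].
have neq : [/\ v != h, o != h, o != v & forall j, j \in s ->
    [/\ j != h, j != v & j != o]].
  move: us; rewrite /= !inE !negb_or => /and4P[/and3P[hv ho hs] /andP[vo vs] os _].
  split; [by rewrite eq_sym|by rewrite eq_sym|by rewrite eq_sym|move=> j js].
  by split; [move: hs|move: vs|move: os]; apply: contraNneq => <-.
case: neq => vh oh ov sN.
have mZ : measurable_fun setT (fun t => (X h t, (X v t, X o t))).
  by do 2 (apply: measurable_fun_pair; first exact: mX); exact: mX.
split => //.
  have mB k k' k'' : measurable_fun setT
      (fun t => X k t + Num.max (X k' t - X k'' t) 0 : mR).
    apply: measurable_funD; first exact: mX.
    apply: measurable_maxr; last exact: measurable_cst.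
    by apply: measurable_funB; exact: mX.
  move=> k; rewrite /burke_step /=; case: eqP => _; first exact: mB.
  case: eqP => _; first exact: mB.
  case: eqP => _; last exact: mX.
  by apply: measurable_minr; exact: mX.
move=> A mA.
pose E := cylinder s X A.
have mE : measurable E by exact: measurable_cylinder.
pose p := \prod_(j <- s) exponential_weight (r j) (A j).
have p0 : 0 <= c * p.
  by rewrite mulr_ge0// prodr_ge0// => j _; exact: exponential_weight_ge0.
have WE0 t : 0 <= W t * \1_E t by rewrite mulr_ge0.
have mWE := measurable_mul_indic mW mE.
pose m : {measure set (mR * (mR * mR)) -> \bar R} :=
  measure_function_pushforward__canonical__measure_function_Measure
    (weighted_measure P WE0 mWE) mZ.
have mrect (A1 A2 A3 : set mR) : measurable A1 -> measurable A2 -> measurable A3 ->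
    m (A1 `*` (A2 `*` A3)) = ((NngNum p0)%:num%:E *
      (exponential_measure (r0 h) A1 *
        (exponential_measure (r0 v) A2 * exponential_measure (r0 o) A3)))%E.
  move=> m1 m2 m3.
  pose A' j := if j == h then A1 else if j == v then A2
               else if j == o then A3 else A j.
  have mA' j : measurable (A' j) by rewrite /A'; do 3 (case: ifP => // _).
  transitivity (\int[P]_(t in cylinder [:: h, v, o & s] X A') (W t)%:E)%E.
    transitivity (\int[P]_(t in (fun t => (X h t, (X v t, X o t))) @^-1`
      (A1 `*` (A2 `*` A3))) (W t * \1_E t)%:E)%E => //.
    rewrite integral_mul_indic; congr (integral _ _ _).
    apply/seteqP; split => t /=.
      move=> [[h1 [h2 h3]] h4] j; rewrite !in_cons /A'.
      case: eqP => [->//|_]; case: eqP => [->//|_]; case: eqP => [->//|_] /=.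
      exact: h4.
    move=> H; split.
      split; first by have := H h; rewrite /A' mem_head eqxx; exact.
      split.
        have := H v; rewrite /A' !in_cons !eqxx orbT (negbTE vh); exact.
      have := H o; rewrite /A' !in_cons !eqxx !orbT (negbTE oh) (negbTE ov).
      exact.
    move=> j js; have := H j; rewrite /A' !in_cons js !orbT.
    by have [/negbTE-> /negbTE-> /negbTE->] := sN j js; exact.
  rewrite law// !big_cons /A' !eqxx (negbTE vh) (negbTE oh) (negbTE ov).
  rewrite (_ : \prod_(j <- s) _ = p); last first.
    apply: eq_big_seq => j js.
    by have [/negbTE-> /negbTE-> /negbTE->] := sN j js.
  apply: (@etrans _ _ ((c * p)%:E * ((exponential_weight (r h) A1)%:E *
    ((exponential_weight (r v) A2)%:E * (exponential_weight (r o) A3)%:E)))%E).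
    exact: prod3_rearrange.
  apply: (congr2 *%E (erefl _)).
  apply: (congr2 *%E); first exact: exponential_weightE.
  by apply: (congr2 *%E); exact: exponential_weightE.
have mS : measurable (@burke_map R @^-1` (A h `*` (A v `*` A o))).
  rewrite -[X in measurable X]setTI; apply: measurable_burke_map => //.
  by apply: measurableX => //; exact: measurableX.
have key := product3_measure_scale_unique mrect mS.
have key2 := burke (r0 h) (r0 v) (r0 o) rhv (mA h) (mA v) (mA o).
transitivity (m (@burke_map R @^-1` (A h `*` (A v `*` A o)))).
  transitivity (\int[P]_(t in (fun t => (X h t, (X v t, X o t))) @^-1`
    (@burke_map R @^-1` (A h `*` (A v `*` A o)))) (W t * \1_E t)%:E)%E => //.
  rewrite integral_mul_indic; congr (integral _ _ _).
  apply/seteqP; split => t /=; rewrite /burke_map /=.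
    move=> H; split.
      split; first by have := H h; rewrite /burke_step mem_head eqxx; exact.
      split.
        by have := H v; rewrite /burke_step !in_cons !eqxx orbT (negbTE vh); exact.
      have := H o; rewrite /burke_step !in_cons !eqxx !orbT (negbTE oh) (negbTE ov).
      exact.
    move=> j js; have := H j; rewrite /burke_step !in_cons js !orbT.
    by have [/negbTE-> /negbTE-> /negbTE->] := sN j js; exact.
  move=> [[h1 [h2 h3]] h4] j; rewrite !in_cons /burke_step.
  case: eqP => [->//|_]; case: eqP => [->//|_]; case: eqP => [->//|_] /=.
  exact: h4.
apply: (etrans key); apply: (etrans (congr2 *%E (erefl _) key2)).
rewrite !big_cons -/p; apply: (etrans _ (esym (prod3_rearrange _ _ _ _ _))).
apply: esym; apply: (congr2 *%E (erefl _)).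
apply: (congr2 *%E); first exact: exponential_weightE.
by apply: (congr2 *%E); exact: exponential_weightE.
Qed.

Lemma perm_to_three (h v o : K) s : uniq [:: h; v; o] ->
  h \in s -> v \in s -> o \in s ->
  exists s', perm_eq s [:: h, v, o & s'].
Proof.
rewrite /= !inE negb_or => /and3P[/andP[hv ho] vo _] hs vs os.
have vs' : v \in rem h s.
  by have := vs; rewrite (perm_mem (perm_to_rem hs)) inE eq_sym (negbTE hv).
have os' : o \in rem v (rem h s).
  have := os; rewrite (perm_mem (perm_to_rem hs)) inE eq_sym (negbTE ho)/=.
  by rewrite (perm_mem (perm_to_rem vs')) inE eq_sym (negbTE vo).
exists (rem o (rem v (rem h s))); rewrite (perm_trans (perm_to_rem hs))//.
rewrite perm_cons (perm_trans (perm_to_rem vs'))// perm_cons.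
exact: perm_to_rem.
Qed.

Lemma independent_exponentials_tilt W c l s X r th :
  uniq s -> uniq l -> {subset l <= s} -> (forall k, k \in l -> th < r k) ->
  independent_exponentials W c s X r ->
  independent_exponentials (fun t => W t * expR (th * \sum_(k <- l) X k t))
    (c * \prod_(k <- l) (r k / (r k - th))) s X
    (fun j => if j \in l then r j - th else r j).
Proof.
elim: l W c r => [|k l IHl] W c r us.
  move=> _ _ _ ie.
  rewrite big_nil mulr1 (_ : (fun t => _) = W)//.
  by apply/funext => t; rewrite big_nil mulr0 expR0 mulr1.
move=> /= /andP[kl ul] ls lr ie.
have ks : k \in s by apply: ls; rewrite mem_head.
have ie' := independent_exponentials_tilt_head _ (lr k (mem_head k l))
  (independent_exponentials_perm (perm_to_rem ks) ie).
have {}ie' : independent_exponentials (fun t => W t * expR (th * X k t))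
    (c * (r k / (r k - th))) s X (fun j => if j == k then r j - th else r j).
  apply: independent_exponentials_perm (ie' _); first by rewrite perm_sym perm_to_rem.
  by rewrite -(perm_uniq (perm_to_rem ks)).
have jk j : j \in l -> (j == k) = false by move=> jl; apply: contraNF kl => /eqP <-.
have lr' j : j \in l -> th < (if j == k then r j - th else r j).
  by move=> jl; rewrite jk// lr// in_cons jl orbT.
have ls' : {subset l <= s} by move=> j jl; apply: ls; rewrite in_cons jl orbT.
have := IHl _ _ _ us ul ls' lr' ie'.
rewrite (_ : (fun t => _ * expR (th * \sum_(k <- l) _)) =
    (fun t => W t * expR (th * \sum_(k <- k :: l) X k t))); last first.
  by apply/funext => t; rewrite big_cons mulrDr expRD mulrA.
rewrite (_ : (fun j => if j \in l then _ else _) =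
    (fun j => if j \in k :: l then r j - th else r j)); last first.
  apply/funext => j; rewrite in_cons; case: ifPn => [/jk->//|].
  by case: eqP => [->|].
rewrite [in X in X -> _](eq_big_seq (fun j => r j / (r j - th))); last first.
  by move=> j /jk ->.
by rewrite big_cons [in X in _ -> X]mulrA.
Qed.

Lemma independent_exponentials_burke W c h v o s X r :
  uniq s -> uniq [:: h; v; o] -> h \in s -> v \in s -> o \in s ->
  r h + r v = r o ->
  independent_exponentials W c s X r ->
  independent_exponentials W c s (fun k t => burke_step h v o (X ^~ t) k) r.
Proof.
move=> us u3 hs vs os rhv ie.
have [s' ss'] := perm_to_three u3 hs vs os.
apply: (@independent_exponentials_perm _ _ [:: h, v, o & s']); first by rewrite perm_sym.
apply: independent_exponentials_burke_head => //.
  by rewrite -(perm_uniq ss').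
exact: independent_exponentials_perm ie.
Qed.

Lemma independent_exponentials_scale W c s X r (a : K -> R) :
  (forall k, 0 < a k) -> independent_exponentials W c s X r ->
  independent_exponentials W c s (fun k t => a k * X k t) (fun k => r k / a k).
Proof.
move=> a0 [W0 mW mX c0 r0 law].
have aE k t : affine (a k) 0 (X k t) = a k * X k t by rewrite /affine addr0.
split; [exact: W0|exact: mW| |exact: c0| |].
- by move=> k; apply: measurable_funM; [exact: measurable_cst|exact: mX].
- by move=> k; rewrite divr_gt0.
move=> A mA.
have -> : cylinder s (fun k t => a k * X k t) A =
    cylinder s X (fun k => affine (a k) 0 @^-1` A k).
  by apply/seteqP; split => t h k ks; have := h k ks; rewrite /= aE.
rewrite law; last first.
  move=> k; rewrite -[X in measurable X]setTI.
  by apply: measurable_affine.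
congr (_ * _)%:E; apply: eq_bigr => k _; rewrite /exponential_weight.
by rewrite (exponential_scale (r0 k) (a0 k)).
Qed.

End independent_exponentials.

(** * The exact moment generating function *)

Section burke_step.
Context (R : realType) (K : choiceType) (h v o : K) (x : K -> measurableTypeR R).

Lemma burke_step_h : burke_step h v o x h = x o + Num.max (x h - x v) 0.
Proof. by rewrite /burke_step eqxx. Qed.

Lemma burke_step_v : v <> h ->
  burke_step h v o x v = x o + Num.max (x v - x h) 0.
Proof. by move=> /eqP/negbTE vh; rewrite /burke_step vh eqxx. Qed.

Lemma burke_step_id k : k <> h -> k <> v -> k <> o ->
  burke_step h v o x k = x k.
Proof.
by move=> /eqP/negbTE kh /eqP/negbTE kv /eqP/negbTE ko;
  rewrite /burke_step kh kv ko.
Qed.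

End burke_step.

(** * Sweeping Burke's map over the rectangle *)

Section burke_sweep.
Context (R : realType).
Local Notation mR := (measurableTypeR R).
Local Notation conf := (nat * nat -> mR).
Implicit Types (x : conf).

(* The horizontal increment of column [i] is kept at [(i, 0)] and the vertical
   increment of row [j] at [(0, j)]; the cells are visited row by row. *)
Fixpoint burke_row (j i : nat) x : conf :=
  if i is i'.+1 then
    burke_step (i, 0%N) (0%N, j) (i, j) (burke_row j i' x)
  else x.

Fixpoint burke_rows (m j : nat) x : conf :=
  if j is j'.+1 then burke_row j m (burke_rows m j' x) else x.

Variable x : conf.
Local Notation G := (last_passage (fun i j => x (i, j) : R)
  (fun i => x (i, 0%N) : R) (fun j => x (0%N, j) : R)).

Let rows_inv m j (y : conf) :=
  [/\ forall i, (i < m)%N -> y (i.+1, 0%N) = G i.+1 j - G i j,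
      forall j', (j <= j')%N -> y (0%N, j'.+1) = x (0%N, j'.+1) &
      forall i j', (j <= j')%N -> y (i.+1, j'.+1) = x (i.+1, j'.+1)].

(** The slots on the axes hold the increments of a down-right staircase: along row [j.+1] up to
    column [i], one step down to row [j], and on along row [j] up to column [m]. Weights beyond the
    staircase are still the original ones. *)
Let row_inv m j i (z : conf) :=
  [/\ forall k, (k < i)%N -> z (k.+1, 0%N) = G k.+1 j.+1 - G k j.+1,
      forall k, (i <= k < m)%N -> z (k.+1, 0%N) = G k.+1 j - G k j,
      z (0%N, j.+1) = G i j.+1 - G i j,
      forall k, (i <= k)%N -> z (k.+1, j.+1) = x (k.+1, j.+1) &
      forall j', (j < j')%N -> z (0%N, j'.+1) = x (0%N, j'.+1) /\
        forall k, z (k.+1, j'.+1) = x (k.+1, j'.+1)].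

Let GS0 j : G 0%N j.+1 = G 0%N j + x (0%N, j.+1).
Proof. by rewrite !last_passage0n big_nat_recr. Qed.

Let G0S i : G i.+1 0%N = G i 0%N + x (i.+1, 0%N).
Proof. by rewrite !last_passagem0 [LHS]big_nat_recr. Qed.

Let burke_row_inv m j i y : rows_inv m j y -> (i <= m)%N ->
  row_inv m j i (burke_row j.+1 i y).
Proof.
move=> [y1 y2 y3]; elim: i => [_|i IHi im].
  split => //; rewrite -?[burke_row _ 0 _]/y.
  - by rewrite y2// GS0 addrC addKr.
  - by move=> k _; exact: y3.
  - by move=> j' /ltnW jj'; split; [exact: y2|move=> k; exact: y3].
have [z1 z2 z3 z4 z5] := IHi (ltnW im).
set z := burke_row j.+1 i y in z1 z2 z3 z4 z5 *.
have zh : z (i.+1, 0%N) = G i.+1 j - G i j by apply: z2; rewrite leqnn.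
have zo : z (i.+1, j.+1) = x (i.+1, j.+1) by exact: z4.
have maxE (a b : R) : Num.max (a - b) 0 + b = Num.max a b.
  by rewrite addr_maxl subrK add0r.
rewrite -[burke_row _ _ _]/(burke_step (i.+1, 0%N) (0%N, j.+1) (i.+1, j.+1) z).
split.
- move=> k; rewrite ltnS leq_eqVlt => /predU1P[->|ki].
    rewrite burke_step_h zh zo z3 last_passageSS.
    rewrite (_ : G i.+1 j - G i j - (G i j.+1 - G i j) = G i.+1 j - G i j.+1); last by ring.
    rewrite [Num.max (G i j.+1) _]maxC -(maxE (G i.+1 j)).
    by rewrite addrA addrK.
  by rewrite burke_step_id => [||[]|[]]//; [exact: z1|move=> [ki']; rewrite ki' ltnn in ki].
- move=> k /andP[ik km].
  rewrite burke_step_id => [||[]|[]]//; first by apply: z2; rewrite (ltnW ik).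
  by move=> [ki']; rewrite ki' ltnn in ik.
- rewrite burke_step_v// zh zo z3 last_passageSS.
  rewrite (_ : G i j.+1 - G i j - (G i.+1 j - G i j) = G i j.+1 - G i.+1 j); last by ring.
  rewrite -(maxE (G i j.+1)).
  by rewrite addrA addrK.
- move=> k ik.
  rewrite burke_step_id => [|[]|[]|]//; first exact: z4 (ltnW ik).
  by move=> [ki']; rewrite ki' ltnn in ik.
- move=> j' jj'; have [h1 h2] := z5 _ jj'.
  split=> [|k].
    rewrite burke_step_id => [||[]|[]]//.
    by move=> [ki']; rewrite ki' ltnn in jj'.
  rewrite burke_step_id => [||[]|[]]//.
  by move=> _ ki'; rewrite ki' ltnn in jj'.
Qed.

Let burke_rows_inv m j : rows_inv m j (burke_rows m j x).
Proof.
elim: j => [|j IHj].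
  by split => // i im; rewrite G0S addrC addKr.
have [z1 _ _ z4 z5] := burke_row_inv IHj (leqnn m).
split => //.
- by move=> j' jj'; have [] := z5 j' jj'.
- by move=> i j' jj'; have [_] := z5 j' jj'; exact.
Qed.

Lemma sum_burke_rows m n :
  \sum_(1 <= i < m.+1) burke_rows m n x (i, 0%N) =
  G m n - \sum_(1 <= j < n.+1) x (0%N, j).
Proof.
rewrite big_add1 /= -(last_passage0n (fun i j => x (i, j)) (fun i => x (i, 0%N))).
transitivity (\sum_(0 <= i < m) (G i.+1 n - G i n)).
  have [h _ _] := burke_rows_inv m n.
  by rewrite !big_nat; apply: eq_bigr => i /andP[_ im]; exact: h.
by rewrite (telescope_sumr (fun i => G i n)).
Qed.

End burke_sweep.

(** The origin is left out because its weight is the constant 0, not an exponential variable. *)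
Definition rectangle (m n : nat) : seq (nat * nat) :=
  [seq p <- [seq (i, j) | i <- iota 0 m.+1, j <- iota 0 n.+1] | p != (0%N, 0%N)].

Lemma rectangle_uniq m n : uniq (rectangle m n).
Proof.
rewrite filter_uniq// allpairs_uniq ?iota_uniq// => -[i j] [k l] _ _ /=.
by move=> [-> ->].
Qed.

Lemma mem_rectangle m n i j : (i <= m)%N -> (j <= n)%N ->
  (i, j) <> (0%N, 0%N) -> (i, j) \in rectangle m n.
Proof.
move=> im jn /eqP ij; rewrite mem_filter ij andTb.
by apply: allpairs_f; rewrite mem_iota.
Qed.

Lemma uniq3 (K : eqType) (a b c : K) : a <> b -> a <> c -> b <> c ->
  uniq [:: a; b; c].
Proof. by move=> /eqP ab /eqP ac /eqP bc; rewrite /= !inE negb_or ab ac bc. Qed.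

Section exact.
Context d (T : measurableType d) (R : realType) (P : probability T R).
Local Notation mR := (measurableTypeR R).

(** The value 1 at the origin is a default which keeps all rates positive, as [ie_rate_gt0]
    demands. *)
Definition boundary_rate (al be : R) (k : nat * nat) : R :=
  match k with
  | (0, 0)%N => 1
  | (_.+1, 0)%N => al
  | (0, _.+1)%N => be
  | (_.+1, _.+1)%N => 1
  end.

Definition last_passage_at (X : nat * nat -> T -> R) (m n : nat) (t : T) : R :=
  last_passage (fun i j => X (i, j) t) (fun i => X (i, 0%N) t)
    (fun j => X (0%N, j) t) m n.

(* Tilting the vertical boundary by [th = al + be - 1] turns the rate [be] into
   [1 - al]; for these weights [burke] makes the increments along row [n]
   independent and exponential with rate [al]. *)
Theorem last_passage_mgf (al be : R) (X : nat * nat -> T -> mR) (m n : nat) :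
  0 < al < 1 -> 0 < be < 1 ->
  independent_exponentials P (cst 1) 1 (rectangle m n) X (boundary_rate al be) ->
  (\int[P]_t (expR ((al + be - 1) * last_passage_at X m n t))%:E =
   ((be / (1 - al)) ^+ n * (al / (1 - be)) ^+ m)%:E)%E.
Proof.
move=> /andP[al0 al1] /andP[be0 be1] ie.
set th := al + be - 1.
pose l : seq (nat * nat) := [seq (0%N, j) | j <- index_iota 1 n.+1].
pose l2 : seq (nat * nat) := [seq (i, 0%N) | i <- index_iota 1 m.+1].
have ul : uniq l by rewrite map_inj_uniq ?iota_uniq// => i j [].
have ul2 : uniq l2 by rewrite map_inj_uniq ?iota_uniq// => i j [].
have lE j : ((0%N, j) \in l) = (1 <= j <= n)%N.
  rewrite -[RHS](mem_index_iota 1 n.+1); apply/mapP/idP => [[k kn [->]]//|jn].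
  by exists j.
have ls : {subset l <= rectangle m n}.
  move=> k /mapP[j]; rewrite mem_index_iota => /andP[j1 jn] ->.
  by apply: mem_rectangle => // -[j0]; rewrite j0 in j1.
have l2s : {subset l2 <= rectangle m n}.
  move=> k /mapP[j]; rewrite mem_index_iota => /andP[j1 jn] ->.
  by apply: mem_rectangle => // -[j0]; rewrite j0 in j1.
have lr k : k \in l -> boundary_rate al be k = be.
  by move=> /mapP[j]; rewrite mem_index_iota => /andP[j1 jn] ->; case: j j1 {jn}.
have ie1 := @independent_exponentials_tilt _ _ _ _ _ _ _ l _ _ _ th
  (rectangle_uniq m n) ul ls _ ie.
have {}ie1 := ie1 _.
(* These two bounds amount to [al < 1] and [be < 1]; they keep the rates positive after each of the
   two tilts. *)
have th_be : th < be by rewrite /th; lra.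
have th_al : th < al by rewrite /th; lra.
have {}ie1 := ie1 (fun k kl => eq_ind_r (fun r => th < r) th_be (lr k kl)).
move: ie1; set W1 := (fun t => _); set r1 := (fun k => if _ then _ else _) => ie1.
(* After the first tilt the rates are [al] along the bottom, [1 - al] along the left side and 1
   inside, so the rate condition of Burke's theorem holds in every cell and is reproduced by each
   step. *)
have r1h i : r1 (i.+1, 0%N) = al by rewrite /r1 ifF//; apply/mapP => -[].
have r1v j : (1 <= j <= n)%N -> r1 (0%N, j) = 1 - al.
  by move=> jn; rewrite /r1 lE jn lr ?lE// /th; ring.
have r1o i j : r1 (i.+1, j.+1) = 1 by rewrite /r1 ifF//; apply/mapP => -[].
set c1 := 1 * _ in ie1.
have ie2 j : (j <= n)%N -> independent_exponentials P W1 c1 (rectangle m n)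
    (fun k t => burke_rows m j (X ^~ t) k) r1.
  elim: j => [_|j IHj jn]; first exact: ie1.
  suff : forall i, (i <= m)%N -> independent_exponentials P W1 c1 (rectangle m n)
    (fun k t => burke_row j.+1 i (burke_rows m j (X ^~ t)) k) r1 by exact.
  elim=> [_|i IHi im]; first exact: IHj (ltnW jn).
  apply: (independent_exponentials_burke (rectangle_uniq m n) _ _ _ _ _
    (IHi (ltnW im))) => //.
  - exact: uniq3.
  - exact: mem_rectangle.
  - exact: mem_rectangle.
  - exact: mem_rectangle.
  - by rewrite r1h r1v// r1o addrC subrK.
have r1l2 k : k \in l2 -> r1 k = al.
  by move=> /mapP[j]; rewrite mem_index_iota => /andP[j1 jn] ->; case: j j1 {jn}.
(* A second tilt, of the increments along row [n], turns their rate [al] into [1 - be]. The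
   exponents of both tilts add up to [th] times the last-passage value, so the total mass of the
   resulting density is the moment generating function. *)
have ie3 := independent_exponentials_tilt (rectangle_uniq m n) ul2 l2s
  (fun k kl => eq_ind_r (fun r => th < r) th_al (r1l2 k kl)) (ie2 n (leqnn n)).
have := ie_law ie3 (A := fun=> setT) (fun=> measurableT).
rewrite (_ : cylinder _ _ _ = setT); last by apply/seteqP; split.
rewrite [X in _ = (_ * X)%:E]big1_seq ?mulr1; last first.
  by move=> k _; apply: exponential_weightT; exact: ie_rate_gt0 ie3 k.
have c1E : c1 = (be / (1 - al)) ^+ n.
  rewrite /c1 mul1r /l big_map (eq_big_nat _ _ (F2 := fun=> be / (1 - al))).
    by rewrite prodr_const_nat subn1.
  move=> j jn; rewrite lr ?lE//; congr (_ / _); rewrite /th; ring.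
have -> : \prod_(k <- l2) (r1 k / (r1 k - th)) = (al / (1 - be)) ^+ m.
  rewrite /l2 big_map (eq_big_nat _ _ (F2 := fun=> al / (1 - be))).
    by rewrite prodr_const_nat subn1.
  by case=> // i _; rewrite r1h; congr (_ / _); rewrite /th; ring.
rewrite c1E => <-; apply: eq_integral => t _; congr _%:E.
rewrite /W1 /= mul1r -expRD -mulrDr /l /l2 !big_map sum_burke_rows.
by rewrite addrC subrK.
Qed.

End exact.

(** * Arbitrary boundary rates on the given probability space *)

Section stationary_model.
Context d (T : measurableType d) (R : realType) (P : probability T R).
Variables (omega : nat -> nat -> {RV P >-> R}) (I J : nat -> {RV P >-> R}).
Variable rho : R.
Hypotheses (rho0 : 0 < rho) (rho1 : rho < 1).
Hypothesis omega_law : forall i j : nat, (0 < i)%N -> (0 < j)%N ->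
  has_exponential_law 1 (omega i j).
Hypothesis I_law : forall i : nat, (0 < i)%N ->
  has_exponential_law (1 - rho) (I i).
Hypothesis J_law : forall j : nat, (0 < j)%N -> has_exponential_law rho (J j).
Hypothesis indep :
  mutually_independent_on [set x : nat * nat | x != (0%N, 0%N)]
    (lattice_weight omega I J).
Local Notation X := (lattice_weight omega I J).

Lemma lattice_weight_law k : k <> (0%N, 0%N) ->
  has_exponential_law (boundary_rate (1 - rho) rho k) (X k).
Proof.
case: k => -[|i] [|j] //= _; [exact: J_law|exact: I_law|exact: omega_law].
Qed.

Lemma boundary_rate_gt0 (al be : R) k : 0 < al -> 0 < be ->
  0 < boundary_rate al be k.
Proof. by case: k => -[|i] [|j]. Qed.

Lemma stationary_independent m n :
  independent_exponentials P (cst 1) 1 (rectangle m n) (fun k t => X k t)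
    (boundary_rate (1 - rho) rho).
Proof.
have r0 k : 0 < boundary_rate (1 - rho) rho k.
  by apply: boundary_rate_gt0; rewrite ?subr_gt0.
split=> [t|||||A mA].
- exact: ler01.
- exact: measurable_cst.
- by move=> k; exact: (measurable_funP (X k)).
- exact: ler01.
- exact: r0.
pose F : {fset nat * nat} := seq_fset tt (rectangle m n).
have Fp : perm_eq F (rectangle m n).
  apply: uniq_perm; rewrite ?fset_uniq ?rectangle_uniq//.
  by move=> k; rewrite seq_fsetE.
have mX k : measurable (X k @^-1` A k).
  rewrite -[X in measurable X]setTI.
  by apply: (measurable_funP (X k)) => //; exact: mA.
have := @indep F A _ (fun k _ => mA k).
have cylE : \bigcap_(k in [set` F]) (X k @^-1` A k) =
    cylinder (rectangle m n) (fun k t => X k t) A.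
  apply/seteqP; split => t h k /=.
    by move=> kr; apply: h => /=; rewrite (perm_mem Fp).
  by move=> kF; apply: h; rewrite -(perm_mem Fp).
rewrite cylE => ind.
transitivity (P (cylinder (rectangle m n) (fun k t => X k t) A)).
  have mC : measurable (cylinder (rectangle m n) (fun k t => X k t) A).
    by apply: measurable_cylinder => // k; exact: (measurable_funP (X k)).
  apply: (etrans (integral_cst P mC 1%E)); exact: mul1e.
rewrite ind; last first.
  by move=> k /=; rewrite (perm_mem Fp) mem_filter => /andP[].
rewrite mul1r (perm_big _ Fp) /= -prodEFin.
apply: eq_big_seq => k; rewrite mem_filter => /andP[/eqP k0 _].
rewrite (exponential_weightE (r0 k) (mA k)) exponential_measureE.
exact: lattice_weight_law k0 _ (mA k).
Qed.

Lemma independent_exponentials_rate W c s Y (r r' : nat * nat -> R) :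
  r = r' -> independent_exponentials P W c s Y r ->
  independent_exponentials P W c s Y r'.
Proof. by move=> ->. Qed.

(* [scaled_lpp p q] has boundary rates [(1 - rho) / p] and [rho / q]. *)
Definition scaled_lpp (p q : R) (m n : nat) (t : T) : R :=
  last_passage (fun i j => omega i j t) (fun i => p * I i t)
    (fun j => q * J j t) m n.

Lemma scaled_lpp11 m n : scaled_lpp 1 1 m n = stationary_lpp omega I J m n.
Proof.
apply/funext => t; rewrite /scaled_lpp /stationary_lpp.
by congr (last_passage _ _ _ _ _); apply/funext => i; rewrite mul1r.
Qed.

Let scaling (p q : R) (k : nat * nat) : R :=
  match k with
  | (0, 0)%N => 1
  | (_.+1, 0)%N => p
  | (0, _.+1)%N => q
  | (_.+1, _.+1)%N => 1
  end.

Lemma eq_last_passage (om om' : nat -> nat -> R) (u u' v v' : nat -> R) m n :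
  (forall i j, om i.+1 j.+1 = om' i.+1 j.+1) -> (forall i, u i.+1 = u' i.+1) ->
  (forall j, v j.+1 = v' j.+1) ->
  last_passage om u v m n = last_passage om' u' v' m n.
Proof.
move=> eom eu ev; elim: m n => [|m IHm] n.
  by rewrite !last_passage0n; apply: eq_big_nat => -[|j].
elim: n => [|n IHn].
  by rewrite !last_passagem0; apply: eq_big_nat => -[|j].
by rewrite !last_passageSS eom IHm IHn.
Qed.

Lemma scaled_lpp_mgf (al be : R) m n : 0 < al < 1 -> 0 < be < 1 ->
  (\int[P]_t (expR ((al + be - 1) *
      scaled_lpp ((1 - rho) / al) (rho / be) m n t))%:E =
   ((be / (1 - al)) ^+ n * (al / (1 - be)) ^+ m)%:E)%E.
Proof.
move=> al01 be01; have /andP[al0 _] := al01; have /andP[be0 _] := be01.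
have rho1' : 0 < 1 - rho by rewrite subr_gt0.
have p0 : 0 < (1 - rho) / al by rewrite divr_gt0.
have q0 : 0 < rho / be by rewrite divr_gt0.
pose a := scaling ((1 - rho) / al) (rho / be).
have a0 k : 0 < a k by case: k => -[|i] [|j].
have ie := independent_exponentials_scale a0 (stationary_independent m n).
have rE : (fun k => boundary_rate (1 - rho) rho k / a k) = boundary_rate al be.
  apply/funext => -[[|i] [|j]] /=; rewrite ?divr1//.
    by field; rewrite !gt_eqF.
  by field; rewrite !gt_eqF.
rewrite -(last_passage_mgf al01 be01 (independent_exponentials_rate rE ie)).
apply: eq_integral => t _; congr (expR (_ * _))%:E.
by apply: eq_last_passage => *; rewrite /a /= ?mul1r.
Qed.

End stationary_model.

(** * Expansion of the logarithmic moment generating function *)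

Section exponential_bounds.
Context {R : realType}.
Implicit Types x y z : R.

Lemma ndecr_on_pos (f df : R -> R) y z :
  (forall w : R, 0 < w -> is_derive w (1:R) f (df w)) -> 0 < y -> y <= z ->
  (forall w : R, y < w < z -> 0 <= df w) -> f y <= f z.
Proof.
move=> fdf y0 yz df0.
have fd (w : R) : 0 < w -> derivable f w 1 by move=> w0; have [] := fdf w w0.
apply: (@ger0_derive1_ndecr _ f y z) => //.
- by move=> w; rewrite in_itv/= => /andP[yw _]; apply: fd; exact: lt_trans yw.
- move=> w; rewrite in_itv/= => /andP[yw wz]; rewrite derive1E.
  have [_ ->] := fdf w (lt_trans y0 yw).
  by apply: df0; rewrite yw.
- apply: derivable_within_continuous => w; rewrite in_itv/= => /andP[yw _].
  by apply: fd; exact: lt_le_trans yw.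
Qed.

(** The difference of the two sides has derivative [(w - 1)^3 / w], so its minimum is the value 0 at
    [w = 1]. *)
Lemma le_ln_cubic y : 0 < y ->
  ln y <= (y - 1) - (y - 1) ^+ 2 / 2 + (y - 1) ^+ 3 / 3.
Proof.
move=> y0.
pose f (w : R) : R := (w - 1) - (w - 1) ^+ 2 / 2 + (w - 1) ^+ 3 / 3 - ln w.
have f1 : f 1 = 0 by rewrite /f subrr ln1 !expr0n /=; ring.
have df (w : R) : 0 < w -> is_derive w (1 : R) f ((w - 1) ^+ 3 / w).
  move=> w0; have := is_derive1_ln w0 => dln.
  rewrite /f; apply: is_derive_eq.
  by rewrite /GRing.scale/=; field; rewrite gt_eqF.
rewrite -subr_ge0 -/(f y) -f1; have [y1|y1] := leP 1 y.
  apply: (ndecr_on_pos df ltr01 y1) => w /andP[w1 _].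
  by rewrite divr_ge0 ?exprn_ge0// ?subr_ge0 ltW// (lt_trans ltr01).
pose g (w : R) : R := - f w.
have dg (w : R) : 0 < w -> is_derive w (1 : R) g (- ((w - 1) ^+ 3 / w)).
  by move=> w0; have := df w w0 => dfw; rewrite /g; apply: is_derive_eq.
rewrite -lerN2; apply: (ndecr_on_pos dg y0 (ltW y1)) => w /andP[yw w1].
have w0 : 0 < w by exact: lt_trans yw.
rewrite (_ : - ((w - 1) ^+ 3 / w) = (1 - w) ^+ 3 / w); last by field; rewrite gt_eqF.
by rewrite divr_ge0 ?exprn_ge0 ?subr_ge0 ?ltW.
Qed.

Lemma ge_ln_quadratic y : 1 <= y -> (y - 1) - (y - 1) ^+ 2 / 2 <= ln y.
Proof.
move=> y1.
pose f (w : R) : R := ln w - ((w - 1) - (w - 1) ^+ 2 / 2).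
have f1 : f 1 = 0 by rewrite /f subrr ln1 !expr0n /=; ring.
have df (w : R) : 0 < w -> is_derive w (1 : R) f ((w - 1) ^+ 2 / w).
  move=> w0; have := is_derive1_ln w0 => dln.
  rewrite /f; apply: is_derive_eq.
  by rewrite /GRing.scale/=; field; rewrite gt_eqF.
rewrite -subr_ge0 -/(f y) -f1.
apply: (ndecr_on_pos df ltr01 y1) => w /andP[w1 _].
by rewrite divr_ge0 ?sqr_ge0// ltW// (lt_trans ltr01).
Qed.

(** Below 1 the Taylor coefficient 1/3 would give an upper bound. With coefficient 1 the difference
    has derivative [(w - 1)^2 (3 w - 1) / w], which is nonnegative for [w >= 1/3]. *)
Lemma ge_ln_cubic y : 1 / 2 <= y -> y <= 1 ->
  (y - 1) - (y - 1) ^+ 2 / 2 + (y - 1) ^+ 3 <= ln y.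
Proof.
move=> y12 y1; have y0 : 0 < y by lra.
pose f (w : R) : R := (w - 1) - (w - 1) ^+ 2 / 2 + (w - 1) ^+ 3 - ln w.
have f1 : f 1 = 0 by rewrite /f subrr ln1 !expr0n /=; ring.
have df (w : R) : 0 < w ->
    is_derive w (1 : R) f ((w - 1) ^+ 2 * (3 * w - 1) / w).
  move=> w0; have := is_derive1_ln w0 => dln.
  rewrite /f; apply: is_derive_eq.
  by rewrite /GRing.scale/=; field; rewrite gt_eqF.
rewrite -subr_le0 -/(f y) -f1.
apply: (ndecr_on_pos df y0 y1) => w /andP[yw _].
have w0 : 0 <= w by lra.
by rewrite divr_ge0// mulr_ge0 ?sqr_ge0//; lra.
Qed.

Lemma ln1Dx_bounds x : `|x| <= 1 / 2 ->
  `|ln (1 + x) - (x - x ^+ 2 / 2)| <= `|x| ^+ 3.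
Proof.
move=> x12; have /andP[xl xu] : - (1 / 2) <= x <= 1 / 2 by rewrite -ler_norml.
have y0 : 0 < 1 + x by lra.
have c3 : x ^+ 3 <= `|x| ^+ 3 by rewrite -normrX ler_norm.
have c30 : 0 <= `|x| ^+ 3 by rewrite exprn_ge0.
have e : 1 + x - 1 = x by ring.
have := le_ln_cubic y0; rewrite e => up.
rewrite ler_norml; apply/andP; split; last by lra.
have [x0|x0] := leP 0 x.
  have := @ge_ln_quadratic (1 + x); rewrite lerDl x0 e => /(_ isT) lo.
  by lra.
have := @ge_ln_cubic (1 + x); rewrite e => lo.
have xE : x ^+ 3 = - `|x| ^+ 3 by rewrite ltr0_norm//; ring.
have {}lo : x - x ^+ 2 / 2 + x ^+ 3 <= ln (1 + x) by apply: lo; lra.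
lra.
Qed.

Lemma ln_ratio_bounds x y : `|x| <= 1 / 2 -> `|y| <= 1 / 2 ->
  `|ln (1 + x) - ln (1 - y) - (x + y) - (y ^+ 2 - x ^+ 2) / 2| <=
  `|x| ^+ 3 + `|y| ^+ 3.
Proof.
move=> /ln1Dx_bounds hx y12; have := @ln1Dx_bounds (- y).
rewrite normrN sqrrN => /(_ y12) hy.
rewrite (_ : _ - (y ^+ 2 - x ^+ 2) / 2 = (ln (1 + x) - (x - x ^+ 2 / 2)) -
  (ln (1 - y) - (- y - y ^+ 2 / 2))); last by ring.
by apply: (le_trans (ler_normB _ _)); exact: lerD.
Qed.

End exponential_bounds.

Section log_mgf.
Context {R : realType} (rho : R) (m n : nat).
Hypotheses (rho0 : 0 < rho) (rho1 : rho < 1).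

(** Logarithm of the exact moment generating function at boundary rates [1 - rho + u] and [rho + v],
    for which the exponent is [u + v]. *)
Definition log_mgf (u v : R) : R :=
  n%:R * (ln (1 + v / rho) - ln (1 - u / rho)) +
  m%:R * (ln (1 + u / (1 - rho)) - ln (1 - v / (1 - rho))).

(** The coefficient of [u + v] in the expansion of [log_mgf], used as centring constant. *)
Definition lpp_mean : R := m%:R / (1 - rho) + n%:R / rho.

Let rho1' : 0 < 1 - rho. Proof. by rewrite subr_gt0. Qed.

Lemma log_mgfE (u v : R) : - rho < v < 1 - rho -> - (1 - rho) < u < rho ->
  ((rho + v) / (1 - (1 - rho + u))) ^+ n *
  ((1 - rho + u) / (1 - (rho + v))) ^+ m = expR (log_mgf u v).
Proof.
move=> /andP[v1 v2] /andP[u1 u2].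
have pos (x y : R) : 0 < x -> - x < y -> 0 < 1 + y / x.
  by move=> x0 xy; rewrite -(divff (lt0r_neq0 x0)) -mulrDl divr_gt0//; lra.
have a1 := pos _ _ rho0 v1.
have a2 : 0 < 1 - u / rho by rewrite -mulNr; apply: pos => //; lra.
have a3 := pos _ _ rho1' u1.
have a4 : 0 < 1 - v / (1 - rho) by rewrite -mulNr; apply: pos => //; lra.
rewrite /log_mgf expRD ![_%:R * _]mulrC !expRM_natr !expRD !expRN !lnK ?posrE//.
congr (_ ^+ _ * _ ^+ _).
  by field; rewrite !gt_eqF//=; lra.
by field; rewrite !gt_eqF//=; lra.
Qed.

(** The coefficient of [(v^2 - u^2) / 2] in the expansion of [log_mgf]; it vanishes when [(m, n)] is
    proportional to [((1 - rho)^2, rho^2)]. *)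
Definition rate_gap : R := m%:R / (1 - rho) ^+ 2 - n%:R / rho ^+ 2.
Definition cubic_mass : R := m%:R / (1 - rho) ^+ 3 + n%:R / rho ^+ 3.

(** Each logarithm is expanded to second order with a cubic remainder; two of them have denominator
    [rho] and two [1 - rho], whence the factor 2 before [cubic_mass]. *)
Lemma log_mgf_bound (u v h : R) :
  h <= rho / 2 -> h <= (1 - rho) / 2 -> `|u| <= h -> `|v| <= h ->
  `|log_mgf u v - (u + v) * lpp_mean| <=
  h ^+ 2 * `|rate_gap| + 2 * h ^+ 3 * cubic_mass.
Proof.
move=> hr hr' uh vh.
have h0 : 0 <= h by exact: le_trans uh.
have small (x y : R) : 0 < x -> h <= x / 2 -> `|y| <= h -> `|y / x| <= 1 / 2.
  move=> x0 hx yh; rewrite normrM normfV (gtr0_norm x0) ler_pdivrMr//; lra.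
have N := ln_ratio_bounds (small _ _ rho0 hr vh) (small _ _ rho0 hr uh).
have M := ln_ratio_bounds (small _ _ rho1' hr' uh) (small _ _ rho1' hr' vh).
have cube (x y : R) : 0 < x -> `|y| <= h -> `|y / x| ^+ 3 <= h ^+ 3 / x ^+ 3.
  move=> x0 yh; rewrite normrM normfV (gtr0_norm x0) exprMn exprVn.
  by rewrite ler_pM2r ?invr_gt0 ?exprn_gt0// lerXn2r// nnegrE.
have cu := cube _ _ rho0 uh; have cv := cube _ _ rho0 vh.
have cu' := cube _ _ rho1' uh; have cv' := cube _ _ rho1' vh.
have {}N := le_trans N (lerD cv cu).
have {}M := le_trans M (lerD cu' cv').
have n0 : 0 <= n%:R :> R by []. have m0 : 0 <= m%:R :> R by [].
have {}N := ler_wpM2l n0 N; have {}M := ler_wpM2l m0 M.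
rewrite -{1}(ger0_norm n0) -normrM in N.
rewrite -{1}(ger0_norm m0) -normrM in M.
rewrite (_ : log_mgf u v - _ = n%:R * (ln (1 + v / rho) - ln (1 - u / rho) -
    (v / rho + u / rho) - ((u / rho) ^+ 2 - (v / rho) ^+ 2) / 2) +
   m%:R * (ln (1 + u / (1 - rho)) - ln (1 - v / (1 - rho)) -
    (u / (1 - rho) + v / (1 - rho)) -
      ((v / (1 - rho)) ^+ 2 - (u / (1 - rho)) ^+ 2) / 2) +
   (v ^+ 2 - u ^+ 2) / 2 * rate_gap); last first.
  rewrite /log_mgf /lpp_mean /rate_gap.
  by field; rewrite !gt_eqF.
have D : `|(v ^+ 2 - u ^+ 2) / 2 * rate_gap| <= h ^+ 2 * `|rate_gap|.
  rewrite normrM ler_wpM2r//.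
  have u2 : u ^+ 2 <= h ^+ 2 by rewrite -(ger0_norm (sqr_ge0 u)) normrX lerXn2r ?nnegrE.
  have v2 : v ^+ 2 <= h ^+ 2 by rewrite -(ger0_norm (sqr_ge0 v)) normrX lerXn2r ?nnegrE.
  have := sqr_ge0 u; have := sqr_ge0 v => v20 u20.
  by rewrite ler_norml; apply/andP; split; lra.
apply: (le_trans (ler_normD _ _)); rewrite addrC lerD//.
apply: (le_trans (ler_normD _ _)); apply: (le_trans (lerD N M)).
rewrite /cubic_mass le_eqVlt; apply/orP; left; apply/eqP.
by field; rewrite !gt_eqF.
Qed.

(** The cubic gain comes from [- ln (1 - v / (1 - rho))], whose Taylor terms are all positive; in
    the factor with [n] a second-order lower bound suffices. *)
Lemma log_mgf_cubic_lower (v : R) : 0 <= v -> v < 1 - rho ->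
  v * lpp_mean + v ^+ 2 / 2 * rate_gap + v ^+ 3 / 3 * (m%:R / (1 - rho) ^+ 3) <=
  log_mgf 0 v.
Proof.
move=> v0 v1.
have x0 : 0 <= v / rho by rewrite divr_ge0 ?(ltW rho0).
have e1 : 1 + v / rho - 1 = v / rho by ring.
have e2 : 1 - v / (1 - rho) - 1 = - (v / (1 - rho)) by ring.
have := @ge_ln_quadratic _ (1 + v / rho); rewrite lerDl x0 e1 => /(_ isT) N.
have y0 : 0 < 1 - v / (1 - rho).
  by rewrite subr_gt0 ltr_pdivrMr// mul1r.
have M := le_ln_cubic y0; rewrite e2 in M.
have n0 : 0 <= n%:R :> R by []. have m0 : 0 <= m%:R :> R by [].
have {}N := ler_wpM2l n0 N; have {}M := ler_wpM2l m0 M.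
rewrite /log_mgf !mul0r subr0 addr0 !ln1 subr0 sub0r mulrN.
rewrite -lerN2 in M; apply: le_trans (lerD N M).
rewrite le_eqVlt /lpp_mean /rate_gap; apply/orP; left; apply/eqP.
by field; rewrite !gt_eqF.
Qed.

End log_mgf.

(** * Pathwise comparisons *)

Section last_passage_order.
Context {R : realType}.
Implicit Types (om : nat -> nat -> R) (u v : nat -> R).

(* A path leaves the origin along one of the two axes and then ignores the
   other boundary, so [u'] and [v'] are arbitrary. *)
Lemma last_passage_le_max om u v u' v' m n :
  last_passage om u v m n <=
  Num.max (last_passage om u v' m n) (last_passage om u' v m n).
Proof.
elim: m n => [|m IHm] n; first by rewrite le_max !last_passage0n lexx orbT.
elim: n => [|n IHn]; first by rewrite le_max !last_passagem0 lexx.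
rewrite !last_passageSS -addr_maxr lerD2l ge_max; apply/andP; split.
  by apply: (le_trans (IHm n.+1)); rewrite ge_max !le_max !lexx !orbT.
by apply: (le_trans IHn); rewrite ge_max !le_max !lexx !orbT.
Qed.

(** The weight of each path is affine in the boundary, and a maximum of affine functions is
    convex. *)
Lemma last_passage_midpoint om u v v' m n :
  last_passage om u (fun j => (v j + v' j) / 2) m n <=
  (last_passage om u v m n + last_passage om u v' m n) / 2.
Proof.
elim: m n => [|m IHm] n.
  by rewrite !last_passage0n -mulr_suml big_split.
elim: n => [|n IHn]; first by rewrite !last_passagem0; lra.
rewrite !last_passageSS.
have mid (o a a' b b' x y : R) : x <= (a + a') / 2 -> y <= (b + b') / 2 ->
    o + Num.max x y <= (o + Num.max a b + (o + Num.max a' b')) / 2.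
  have [] : a <= Num.max a b /\ b <= Num.max a b by rewrite !le_max !lexx orbT.
  have [] : a' <= Num.max a' b' /\ b' <= Num.max a' b'.
    by rewrite !le_max !lexx orbT.
  move=> h1 h2 h3 h4 h5 h6; rewrite -lerBrDl ge_max.
  by apply/andP; split; lra.
exact: mid (IHm n.+1) IHn.
Qed.

Lemma le_last_passage om u v v' m n : (forall j, (j < n)%N -> v j.+1 <= v' j.+1) ->
  last_passage om u v m n <= last_passage om u v' m n.
Proof.
elim: m n => [|m IHm] n vv'.
  rewrite !last_passage0n !big_nat; apply: ler_sum => -[|j]// /andP[_ jn].
  exact: vv'.
elim: n vv' => [|n IHn] vv'; first by rewrite !last_passagem0.
rewrite !last_passageSS lerD2l ge_max !le_max IHm//= IHn ?orbT// => j jn.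
exact: vv' (ltnW jn).
Qed.

Lemma last_passage_ge0 om u v m n :
  (forall i j, (i < m)%N -> (j < n)%N -> 0 <= om i.+1 j.+1) ->
  (forall i, (i < m)%N -> 0 <= u i.+1) -> (forall j, (j < n)%N -> 0 <= v j.+1) ->
  0 <= last_passage om u v m n.
Proof.
elim: m n => [|m IHm] n om0 u0 v0.
  by rewrite last_passage0n big_nat sumr_ge0// => -[|j]// /andP[_ /v0].
case: n om0 v0 => [|n] om0 v0.
  by rewrite last_passagem0 big_nat sumr_ge0// => -[|j]// /andP[_ /u0].
rewrite last_passageSS addr_ge0 ?om0// le_max IHm// => [i j im jn|i im].
  exact: om0 (ltnW im) jn.
exact: u0 (ltnW im).
Qed.

Lemma le_last_passage_weight om u v m n :
  (forall i j, (i < m.+1)%N -> (j < n.+1)%N -> 0 <= om i.+1 j.+1) ->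
  (forall i, (i < m.+1)%N -> 0 <= u i.+1) ->
  (forall j, (j < n.+1)%N -> 0 <= v j.+1) ->
  om m.+1 n.+1 <= last_passage om u v m.+1 n.+1.
Proof.
move=> om0 u0 v0; rewrite last_passageSS lerDl le_max last_passage_ge0//.
  by move=> i j im; exact: om0 (ltnW im).
by move=> i im; exact: u0 (ltnW im).
Qed.

Lemma measurable_last_passage d (T : measurableType d)
    (om : nat -> nat -> T -> R) (u v : nat -> T -> R) m n :
  (forall i j, measurable_fun setT (om i j)) ->
  (forall i, measurable_fun setT (u i)) ->
  (forall j, measurable_fun setT (v j)) ->
  measurable_fun setT (fun t => last_passage (fun i j => om i j t)
    (fun i => u i t) (fun j => v j t) m n).
Proof.
move=> mom mu mv; elim: m n => [|m IHm] n.
  by apply: measurable_sum => j.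
elim: n => [|n IHn]; first by apply: measurable_sum => j.
by apply: measurable_funD => //; exact: measurable_maxr.
Qed.

End last_passage_order.

(** * Moments of the stationary last-passage value *)

Lemma exponential_prob_nonneg (R : realType) (q : R) : 0 < q ->
  exponential_prob q `[0, +oo[%classic = 1%E.
Proof.
move=> q0; rewrite -(integral_exponential_pdf q0) /exponential_prob.
rewrite integral_mkcond; apply: eq_integral => x _; rewrite patchE.
case: ifPn => //; rewrite notin_setE /= in_itv/= andbT.
by move=> /negP; rewrite -ltNge => /lt0_exponential_pdf ->.
Qed.

Section moments.
Context d (T : measurableType d) (R : realType) (P : probability T R).
Variables (omega : nat -> nat -> {RV P >-> R}) (I J : nat -> {RV P >-> R}).
Variable rho : R.
Hypotheses (rho0 : 0 < rho) (rho1 : rho < 1).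
Hypothesis omega_law : forall i j : nat, (0 < i)%N -> (0 < j)%N ->
  has_exponential_law 1 (omega i j).
Hypothesis I_law : forall i : nat, (0 < i)%N ->
  has_exponential_law (1 - rho) (I i).
Hypothesis J_law : forall j : nat, (0 < j)%N -> has_exponential_law rho (J j).
Hypothesis indep :
  mutually_independent_on [set x : nat * nat | x != (0%N, 0%N)]
    (lattice_weight omega I J).
Variables m n : nat.
Local Notation H p q := (scaled_lpp omega I J p q m n).
Local Notation g := (lpp_mean rho m n).

Let rho1' : 0 < 1 - rho. Proof. by rewrite subr_gt0. Qed.

Lemma ge0_le_integral_EFin (f1 f2 : T -> R) : measurable_fun setT f1 ->
  measurable_fun setT f2 -> (forall t, 0 <= f1 t) -> (forall t, 0 <= f2 t) ->
  (\forall t \ae P, f1 t <= f2 t) ->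
  (\int[P]_t (f1 t)%:E <= \int[P]_t (f2 t)%:E)%E.
Proof.
move=> mf1 mf2 f10 f20 f12; apply: ae_ge0_le_integral.
- exact: measurableT.
- by move=> t _; rewrite lee_fin.
- exact/measurable_EFinP.
- by move=> t _; rewrite lee_fin.
- exact/measurable_EFinP.
- by apply: filterS f12 => t f12 _; rewrite lee_fin.
Qed.

Lemma measurable_scaled_lpp (p q : R) : measurable_fun setT (H p q).
Proof.
apply: (@measurable_last_passage _ _ _ (fun i j => omega i j)
  (fun i t => p * I i t) (fun j t => q * J j t)) => [i j|i|j].
- exact: (measurable_funP (omega i j)).
- apply: measurable_funM; first exact: measurable_cst.
  exact: (measurable_funP (I i)).
- apply: measurable_funM; first exact: measurable_cst.
  exact: (measurable_funP (J j)).
Qed.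

Lemma measurable_expR_affine (a b : R) (f : T -> R) : measurable_fun setT f ->
  measurable_fun setT (fun t => expR (a * (f t - b))).
Proof.
move=> mf; apply: (measurableT_comp (f := expR)) => //.
by apply: measurable_funM => //; exact: measurable_funB.
Qed.

(** Exponential of the error in [log_mgf_bound]: one bound for all centred moments with [u] and [v]
    of size at most [h]. *)
Definition tail_bound (h : R) : R :=
  expR (h ^+ 2 * `|rate_gap rho m n| + 2 * h ^+ 3 * cubic_mass rho m n).

Lemma scaled_lpp_centered_mgf (u v : R) :
  - rho < v < 1 - rho -> - (1 - rho) < u < rho ->
  (\int[P]_t (expR ((u + v) *
      (H ((1 - rho) / (1 - rho + u)) (rho / (rho + v)) t - g)))%:E =
   (expR (log_mgf rho m n u v - (u + v) * g))%:E)%E.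
Proof.
move=> v01 u01; have /andP[v0 v1] := v01; have /andP[u0 u1] := u01.
have al01 : 0 < 1 - rho + u < 1 by apply/andP; split; lra.
have be01 : 0 < rho + v < 1 by apply/andP; split; lra.
have := scaled_lpp_mgf rho0 rho1 omega_law I_law J_law indep m n al01 be01.
rewrite (log_mgfE m n rho0 rho1 v01 u01).
rewrite (_ : 1 - rho + u + (rho + v) - 1 = u + v); last by ring.
move=> E; rewrite [RHS](_ : _ = (expR (- ((u + v) * g)))%:E *
  (expR (log_mgf rho m n u v))%:E)%E; last by rewrite -EFinM -expRD addrC.
rewrite -E -ge0_integralZl; last 4 first.
- exact: measurableT.
- apply/measurable_EFinP; apply: (measurableT_comp (f := expR)) => //.
  by apply: measurable_funM => //; exact: measurable_scaled_lpp.
- by move=> t _; rewrite lee_fin expR_ge0.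
- by rewrite lee_fin expR_ge0.
apply: eq_integral => t _; rewrite -EFinM -expRD; congr (expR _)%:E; ring.
Qed.

Lemma scaled_lpp_centered_mgf_le (h u v : R) :
  h <= rho / 2 -> h <= (1 - rho) / 2 -> `|u| <= h -> `|v| <= h ->
  (\int[P]_t (expR ((u + v) *
      (H ((1 - rho) / (1 - rho + u)) (rho / (rho + v)) t - g)))%:E <=
   (tail_bound h)%:E)%E.
Proof.
move=> hr hr' uh vh; have := uh; have := vh.
rewrite !ler_norml => /andP[v0 v1] /andP[u0 u1].
rewrite scaled_lpp_centered_mgf; last 2 first.
- by have := rho0; have := rho1'; move=> *; apply/andP; split; lra.
- by have := rho0; have := rho1'; move=> *; apply/andP; split; lra.
rewrite lee_fin ler_expR; apply: le_trans (ler_norm _) _.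
exact: log_mgf_bound.
Qed.

Lemma expR_max_le (a x y z : R) : 0 <= a -> x <= Num.max y z ->
  expR (a * (x - g)) <= expR (a * (y - g)) + expR (a * (z - g)).
Proof.
move=> a0; rewrite le_max => /orP[xy|xz].
  rewrite -[leLHS]addr0 lerD ?expR_ge0// ler_expR ler_wpM2l// lerD2r//.
rewrite -[leLHS]add0r lerD ?expR_ge0// ler_expR ler_wpM2l// lerD2r//.
Qed.

Lemma expR_midpoint (x y : R) : expR ((x + y) / 2) <= (expR x + expR y) / 2.
Proof.
have -> : expR x = expR (x / 2) ^+ 2 by rewrite -expRM_natr divfK.
have -> : expR y = expR (y / 2) ^+ 2 by rewrite -expRM_natr divfK.
rewrite mulrDl expRD; set a := expR _; set b := expR _.
by have := sqr_ge0 (a - b); lra.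
Qed.

Let mexpH (a p q : R) : measurable_fun setT (fun t => expR (a * (H p q t - g))).
Proof. by apply: measurable_expR_affine; exact: measurable_scaled_lpp. Qed.

Lemma integral_expR_max (a p q p' q' h : R) : 0 <= a ->
  (\int[P]_t (expR (a * (H p q' t - g)))%:E <= (tail_bound h)%:E)%E ->
  (\int[P]_t (expR (a * (H p' q t - g)))%:E <= (tail_bound h)%:E)%E ->
  (\int[P]_t (expR (a * (H p q t - g)))%:E <= (2 * tail_bound h)%:E)%E.
Proof.
move=> a0 h1 h2.
have -> : 2 * tail_bound h = tail_bound h + tail_bound h by ring.
rewrite EFinD; apply: le_trans (leeD h1 h2).
rewrite -ge0_integralD; last 5 first.
- exact: measurableT.
- by move=> t _; rewrite lee_fin expR_ge0.
- exact/measurable_EFinP.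
- by move=> t _; rewrite lee_fin expR_ge0.
- exact/measurable_EFinP.
apply: ge0_le_integral_EFin.
- exact: mexpH.
- by apply: measurable_funD; exact: mexpH.
- by move=> t; exact: expR_ge0.
- by move=> t; rewrite addr_ge0 ?expR_ge0.
- apply: aeW => t; apply: expR_max_le => //.
  exact: last_passage_le_max.
Qed.

(** The comparison models are [(u, v) = (th, 0)] and [(0, th)]: each perturbs a single boundary, and
    both have exponent exactly [th]. *)
Lemma stationary_upper_mgf (th h : R) :
  h <= rho / 2 -> h <= (1 - rho) / 2 -> 0 <= th -> th <= h ->
  (\int[P]_t (expR (th * (H 1 1 t - g)))%:E <= (2 * tail_bound h)%:E)%E.
Proof.
move=> hr hr' th0 thh.
have h0 : 0 <= h by exact: le_trans thh.
have nth : `|th| <= h by rewrite ger0_norm.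
have n0 : `|0 : R| <= h by rewrite normr0.
have := scaled_lpp_centered_mgf_le hr hr' n0 nth.
have := scaled_lpp_centered_mgf_le hr hr' nth n0.
rewrite !addr0 !add0r !divff ?gt_eqF//.
by move=> h1 h2; exact: integral_expR_max h2 h1.
Qed.

(* The vertical boundary is scaled by [s1] and [s2 = 2 * s1 - 1]; convexity of
   the last-passage value in its boundary compares both with the unscaled one. *)
Lemma stationary_lower_mgf (tau h : R) :
  h <= rho / 2 -> h <= (1 - rho) / 2 -> 0 < tau -> 3 * tau <= h ->
  (\int[P]_t (expR (- (tau / 4) * (H 1 1 t - g)))%:E <=
   (2 * tail_bound h)%:E)%E.
Proof.
move=> hr hr' tau0 tauh.
pose s1 := rho / (rho - tau).
pose s2 := (rho + tau) / (rho - tau).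
(* [s1] corresponds to the vertical rate [rho - tau], where [-tau] is an admissible exponent; [v2]
   is the perturbation for which [rho / (rho + v2) = s2]. *)
pose v2 := - (2 * rho * tau / (rho + tau)).
have rt : 0 < rho - tau by lra.
have rt' : 0 < rho + tau by lra.
have v20 : `|v2| <= 2 * tau.
  have p0 : 0 <= 2 * rho * tau by rewrite !mulr_ge0 ?(ltW rho0) ?(ltW tau0).
  rewrite normrN ger0_norm; last exact: divr_ge0 p0 (ltW rt').
  rewrite ler_pdivrMr// mulrDr; have := mulr_gt0 tau0 tau0 => tt.
  by rewrite (_ : 2 * rho * tau = 2 * tau * rho); [lra|ring].
have s2E : rho / (rho + v2) = s2.
  rewrite /s2 /v2 (_ : rho + _ = rho * (rho - tau) / (rho + tau)); last first.
    by field; rewrite gt_eqF.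
  by field; rewrite !gt_eqF.
have I1 : (\int[P]_t (expR (- tau * (H 1 s1 t - g)))%:E <= (tail_bound h)%:E)%E.
  have nt : `|- tau| <= h by rewrite normrN gtr0_norm//; lra.
  have n0 : `|0 : R| <= h by rewrite normr0; lra.
  have := scaled_lpp_centered_mgf_le hr hr' n0 nt.
  by rewrite addr0 add0r divff// gt_eqF.
(* Upper moment at exponent [tau / 2] through the models [(0, tau / 2)] and [(tau / 2 - v2, v2)]. As
   |v2| <= 2 tau, the largest perturbation is at most 5 tau / 2, hence the hypothesis
   [3 * tau <= h]. *)
have I2 : (\int[P]_t (expR (tau / 2 * (H 1 s2 t - g)))%:E <=
    (2 * tail_bound h)%:E)%E.
  have n1 : `|tau / 2| <= h by rewrite ger0_norm; lra.
  have n0 : `|0 : R| <= h by rewrite normr0; lra.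
  have n2 : `|v2| <= h by lra.
  have n3 : `|tau / 2 - v2| <= h.
    by apply: le_trans (ler_normB _ _) _; rewrite (@ger0_norm _ (tau / 2)); lra.
  have := scaled_lpp_centered_mgf_le hr hr' n0 n1.
  have := scaled_lpp_centered_mgf_le hr hr' n3 n2.
  rewrite addr0 add0r divff ?gt_eqF// subrK s2E => h1 h2.
  by apply: integral_expR_max h2 h1; lra.
(* Convexity gives [- (H 1 1 - g) <= - 2 (H 1 s1 - g) + (H 1 s2 - g)]. Multiplied by [tau / 4], the
   right-hand side is the midpoint of the two exponents in [f]. *)
pose f t := (expR (- tau * (H 1 s1 t - g)) + expR (tau / 2 * (H 1 s2 t - g))) / 2.
apply: (@le_trans _ _ (\int[P]_t (f t)%:E)%E).
  apply: ge0_le_integral_EFin.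
  - exact: mexpH.
  - by apply: measurable_funM => //; apply: measurable_funD; exact: mexpH.
  - by move=> t; exact: expR_ge0.
  - by move=> t; rewrite divr_ge0// addr_ge0 ?expR_ge0.
  - apply: aeW => t; apply: le_trans (expR_midpoint _ _); rewrite ler_expR.
    have : H 1 s1 t <= (H 1 1 t + H 1 s2 t) / 2.
      have := last_passage_midpoint (fun i j => omega i j t) (fun i => 1 * I i t)
        (fun j => 1 * J j t) (fun j => s2 * J j t) m n.
      rewrite (_ : (fun j => _ / 2) = (fun j => s1 * J j t))//.
      apply/funext => j; rewrite /s1 /s2; field; rewrite gt_eqF//.
    move=> conv; have := ler_wpM2l (ltW tau0) conv; lra.
have fE : (\int[P]_t (f t)%:E = 2^-1%:E * (\int[P]_t (expR (- tau * (H 1 s1 t - g)))%:E +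
    \int[P]_t (expR (tau / 2 * (H 1 s2 t - g)))%:E))%E.
  rewrite -ge0_integralD; last 5 first.
  - exact: measurableT.
  - by move=> t _; rewrite lee_fin expR_ge0.
  - exact/measurable_EFinP.
  - by move=> t _; rewrite lee_fin expR_ge0.
  - exact/measurable_EFinP.
  rewrite -ge0_integralZl; last 4 first.
  - exact: measurableT.
  - by apply/measurable_EFinP; exact: measurable_funD.
  - by move=> t _; rewrite lee_fin addr_ge0 ?expR_ge0.
  - by rewrite lee_fin.
  by apply: eq_integral => t _; rewrite -EFinD -EFinM mulrC.
rewrite fE; have e0 : 0 < tail_bound h by exact: expR_gt0.
apply: (@le_trans _ _ (2^-1%:E * ((tail_bound h)%:E + (2 * tail_bound h)%:E))%E).
  by rewrite lee_wpmul2l ?lee_fin//; exact: leeD.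
by rewrite -EFinD -EFinM lee_fin; lra.
Qed.

(** * Variance bounds from exponential moments *)

Local Notation mu := (fine ('E_P[H 1 1])%E).
Local Notation V := ('V_P[H 1 1])%E.

Lemma variance_integral (X : T -> R) :
  ('V_P[X] = \int[P]_t ((X t - fine 'E_P[X]) ^+ 2)%:E)%E.
Proof.
rewrite /variance covariance.unlock; set c := fine _.
by rewrite expectation.unlock; apply: eq_integral => t _; rewrite expr2.
Qed.

Lemma integral_affine_le (F : T -> R) (c k b : R) : measurable_fun setT F ->
  (forall t, 0 <= F t) -> 0 <= c -> 0 <= k ->
  (\int[P]_t (F t)%:E <= b%:E)%E ->
  (\int[P]_t (c * F t + k)%:E <= (c * b + k)%:E)%E.
Proof.
move=> mF F0 c0 k0 Fb.
rewrite (_ : (\int[P]_t _)%E = (c%:E * \int[P]_t (F t)%:E + k%:E)%E).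
  by rewrite EFinD EFinM leeD2r// lee_wpmul2l// lee_fin.
transitivity (\int[P]_t ((c * F t)%:E + k%:E))%E => //.
rewrite ge0_integralD; last 5 first.
- exact: measurableT.
- by move=> t _; rewrite lee_fin mulr_ge0.
- by apply/measurable_EFinP; exact: measurable_funM.
- by move=> t _; rewrite lee_fin.
- exact: measurable_cst.
congr (_ + _)%E.
  transitivity (\int[P]_t (c%:E * (F t)%:E))%E => //.
  rewrite ge0_integralZl//; first exact/measurable_EFinP.
  by move=> t _; rewrite lee_fin.
apply: (etrans (integral_cst P measurableT k%:E)).
apply: (etrans (congr2 *%E (erefl _) (probability_setT P))); exact: mule1.
Qed.

Lemma le_cosh (y : R) : `|y| <= expR y + expR (- y).
Proof.
have := expR_ge1Dx y; have := expR_ge1Dx (- y).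
have := expR_ge0 y; have := expR_ge0 (- y) => h1 h2 h3 h4.
by rewrite ler_norml; apply/andP; split; lra.
Qed.

Lemma sqr_le_cosh (y : R) : y ^+ 2 <= 4 * (expR y + expR (- y)).
Proof.
have pos (x : R) : 0 <= x -> x ^+ 2 <= 4 * expR x.
  move=> x0; have -> : expR x = expR (x / 2) ^+ 2 by rewrite -expRM_natr divfK.
  have h := expR_ge1Dx (x / 2).
  have h2 : x / 2 <= expR (x / 2) by lra.
  have : (x / 2) ^+ 2 <= expR (x / 2) ^+ 2.
    by rewrite lerXn2r// nnegrE ?expR_ge0//; lra.
  lra.
have h1 := expR_ge0 y; have h2 := expR_ge0 (- y).
have [y0|y0] := leP 0 y; first by have := pos y y0; lra.
have := pos (- y); rewrite sqrrN oppr_ge0 => /(_ (ltW y0)).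
lra.
Qed.

Lemma stationary_cosh (tau h : R) :
  h <= rho / 2 -> h <= (1 - rho) / 2 -> 0 < tau -> 3 * tau <= h ->
  (\int[P]_t (expR (tau / 4 * (H 1 1 t - g)) +
              expR (- (tau / 4 * (H 1 1 t - g))))%:E <= (4 * tail_bound h)%:E)%E.
Proof.
move=> hr hr' tau0 tauh.
have h1 : (\int[P]_t (expR (tau / 4 * (H 1 1 t - g)))%:E <= (2 * tail_bound h)%:E)%E.
  by apply: stationary_upper_mgf => //; lra.
have h2 := stationary_lower_mgf hr hr' tau0 tauh.
have -> : 4 * tail_bound h = 2 * tail_bound h + 2 * tail_bound h by ring.
rewrite EFinD; apply: le_trans (leeD h1 h2).
rewrite -ge0_integralD; last 5 first.
- exact: measurableT.
- by move=> t _; rewrite lee_fin expR_ge0.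
- by apply/measurable_EFinP; exact: mexpH.
- by move=> t _; rewrite lee_fin expR_ge0.
- by apply/measurable_EFinP; exact: mexpH.
by under [leRHS]eq_integral do rewrite -EFinD mulNr.
Qed.

Let mH := measurable_scaled_lpp.

Let mcosh (tau : R) : measurable_fun setT (fun t =>
  expR (tau / 4 * (H 1 1 t - g)) + expR (- (tau / 4 * (H 1 1 t - g)))).
Proof.
apply: measurable_funD; first exact: mexpH.
by under eq_fun do rewrite -mulNr; exact: mexpH.
Qed.

Let cosh_ge0 (y : R) : 0 <= expR y + expR (- y).
Proof. by rewrite addr_ge0 ?expR_ge0. Qed.

Lemma stationary_mean_bound (tau h : R) :
  h <= rho / 2 -> h <= (1 - rho) / 2 -> 0 < tau -> 3 * tau <= h ->
  `|mu - g| <= 16 / tau * tail_bound h.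
Proof.
move=> hr hr' tau0 tauh.
have mHg : measurable_fun setT (fun t => H 1 1 t - g).
  by apply: measurable_funB => //; exact: mH.
have abs : (\int[P]_t `|(H 1 1 t - g)%:E| <= (16 / tau * tail_bound h)%:E)%E.
  rewrite (_ : 16 / tau * tail_bound h = 4 / tau * (4 * tail_bound h) + 0); last first.
    by ring.
  apply: (le_trans _ (integral_affine_le _ _ _ (lexx 0)
    (stationary_cosh hr hr' tau0 tauh))); last 3 first.
  - exact: mcosh.
  - by move=> t; exact: cosh_ge0.
  - by rewrite divr_ge0// ltW.
  apply: (@ge0_le_integral_EFin (fun t => `|H 1 1 t - g|)).
  - exact: measurableT_comp.
  - apply: measurable_funD => //; apply: measurable_funM => //; exact: mcosh.
  - by move=> t.
  - by move=> t; rewrite addr0 mulr_ge0 ?cosh_ge0// divr_ge0// ltW.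
  - apply: aeW => t; rewrite addr0; have := le_cosh (tau / 4 * (H 1 1 t - g)).
    rewrite normrM gtr0_norm ?divr_gt0// => le.
    rewrite mulrAC ler_pdivlMr//; lra.
(* Integrability is what makes [mu], defined with [fine], the true mean. *)
have intHg : P.-integrable setT (fun t => (H 1 1 t - g)%:E).
  apply/integrableP; split; first exact/measurable_EFinP.
  by apply: le_lt_trans abs _; rewrite ltry.
have intg : P.-integrable setT (fun=> g%:E) by exact: finite_measure_integrable_cst.
have -> : mu = fine (\int[P]_t (H 1 1 t - g)%:E)%E + g.
  rewrite expectation.unlock.
  rewrite (eq_integral (fun t => (H 1 1 t - g)%:E + g%:E)%E); last first.
    by move=> t _; rewrite -EFinD subrK.
  rewrite integralD// (_ : (\int[P]_x g%:E)%E = g%:E).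
    by rewrite fineD ?integral_fune_fin_num.
  apply: (etrans (integral_cst P measurableT g%:E)).
  by apply: (etrans (congr2 *%E (erefl _) (probability_setT P))); exact: mule1.
rewrite addrK -lee_fin -abse_EFin fineK ?integral_fune_fin_num//.
apply: le_trans abs; apply: le_abse_integral => //; exact/measurable_EFinP.
Qed.

Lemma stationary_variance_upper (tau h : R) :
  h <= rho / 2 -> h <= (1 - rho) / 2 -> 0 < tau -> 3 * tau <= h ->
  (V <= (512 / tau ^+ 2 * (tail_bound h + tail_bound h ^+ 2))%:E)%E.
Proof.
move=> hr hr' tau0 tauh.
have mb := stationary_mean_bound hr hr' tau0 tauh.
have B0 : 0 < tail_bound h by exact: expR_gt0.
have c0 : 0 <= 16 / tau by rewrite divr_ge0// ltW.
have c1 : 0 <= 128 / tau ^+ 2 by rewrite divr_ge0// exprn_ge0// ltW.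
have cB : 0 <= 16 / tau * tail_bound h by rewrite mulr_ge0// ltW.
rewrite variance_integral.
(* From [(x - mu)^2 <= 2 (x - g)^2 + 2 (mu - g)^2]: the first term costs [2 * 64 * 4] by
   [sqr_le_cosh] and [stationary_cosh], the second [2 * 16^2] by the mean bound; both equal 512. *)
rewrite (_ : 512 / tau ^+ 2 * _ = 128 / tau ^+ 2 * (4 * tail_bound h) +
  2 * (16 / tau * tail_bound h) ^+ 2); last by field; rewrite gt_eqF.
apply: (le_trans _ (integral_affine_le _ _ _ _
    (stationary_cosh hr hr' tau0 tauh))); last 4 first.
- exact: mcosh.
- by move=> t; exact: cosh_ge0.
- exact: c1.
- by rewrite mulr_ge0// exprn_ge0// mulr_ge0// ltW.
apply: ge0_le_integral_EFin.
- by apply: measurable_funX; apply: measurable_funB => //; exact: mH.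
- apply: measurable_funD => //; apply: measurable_funM => //; exact: mcosh.
- by move=> t; exact: sqr_ge0.
- move=> t; apply: addr_ge0; first exact: mulr_ge0 c1 (cosh_ge0 _).
  by apply: mulr_ge0 => //; exact: exprn_ge0.
- apply: aeW => t; set x := H 1 1 t.
  have s1 : (x - mu) ^+ 2 <= 2 * (x - g) ^+ 2 + 2 * (mu - g) ^+ 2.
    by have := sqr_ge0 ((x - g) + (mu - g)); lra.
  have s2 : (mu - g) ^+ 2 <= (16 / tau * tail_bound h) ^+ 2.
    by rewrite -(ger0_norm (sqr_ge0 _)) normrX lerXn2r ?nnegrE.
  have s3 : (x - g) ^+ 2 <= 64 / tau ^+ 2 * (expR (tau / 4 * (x - g)) + expR (- (tau / 4 * (x - g)))).
    have := sqr_le_cosh (tau / 4 * (x - g)); rewrite exprMn expr_div_n => le.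
    by rewrite mulrAC ler_pdivlMr ?exprn_gt0//; lra.
  lra.
Qed.

Lemma stationary_weights_ge0 :
  \forall t \ae P, forall k, k \in rectangle m n ->
    0 <= lattice_weight omega I J k t.
Proof.
have ie := stationary_independent rho0 rho1 omega_law I_law J_law indep m n.
pose A (k : nat * nat) : set (measurableTypeR R) := `[0, +oo[%classic.
have mA k : measurable (A k) by exact: measurable_itv.
have mC := measurable_cylinder (rectangle m n) (ie_var_measurable ie) mA.
set C := cylinder _ _ _ in mC.
exists (~` C); split; first exact: measurableC.
- rewrite probability_setC// (_ : P C = 1%E) ?subee//.
  transitivity (\int[P]_(t in C) (cst 1 t)%:E)%E.
    by apply: esym; apply: (etrans (integral_cst P mC 1%E)); exact: mul1e.
  rewrite (ie_law ie mA) mul1r big1_seq// => k _.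
  have r0 := ie_rate_gt0 ie k.
  by rewrite /exponential_weight exponential_prob_nonneg.
- apply: subsetC => t h k kr; have := h k kr.
  by rewrite /A/= in_itv/= andbT.
Qed.

Lemma stationary_mgf_lower (th : R) : 0 <= th -> th < 1 - rho ->
  ((expR (log_mgf rho m n 0 th - th * g))%:E <=
    \int[P]_t (expR (th * (H 1 1 t - g)))%:E)%E.
Proof.
move=> th0 th1.
have := @scaled_lpp_centered_mgf 0 th; rewrite addr0 add0r divff ?gt_eqF//.
move=> <-; last 2 first.
- by have := rho0; move=> *; apply/andP; split; lra.
- by have := rho1'; have := rho0; move=> *; apply/andP; split; lra.
apply: ge0_le_integral_EFin.
- exact: mexpH.
- exact: mexpH.
- by move=> t; exact: expR_ge0.
- by move=> t; exact: expR_ge0.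
(* Scaling [J] by [rho / (rho + th)] lowers it only where it is nonnegative, so the comparison holds
   almost everywhere. *)
apply: filterS stationary_weights_ge0 => t w0.
rewrite ler_expR ler_wpM2l// lerD2r; apply: le_last_passage => j jn.
have J0 : 0 <= J j.+1 t by apply: (w0 (0%N, j.+1)); exact: mem_rectangle.
by rewrite ler_wpM2r// ler_pdivrMr ?mul1r ?lerDl// ltr_wpDr.
Qed.

Lemma variance_lower_of_mgf (th D : R) : 0 < th -> 0 < D ->
  (3%:E <= \int[P]_t (expR (th * (H 1 1 t - mu)))%:E)%E ->
  (\int[P]_t (expR (2 * th * (H 1 1 t - mu)))%:E <= D%:E)%E ->
  ((4 / (D * th ^+ 2))%:E <= V)%E.
Proof.
move=> th0 D0 lo up.
have V0 : (0 <= V)%E by rewrite variance_integral; apply: integral_ge0 => t _; rewrite lee_fin sqr_ge0.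
(* An infinite variance satisfies the bound trivially; the remaining case has a real value [x]. *)
case VE : V V0 => [x| |]; last 2 first.
- by move=> _; rewrite leey.
- by rewrite leNgt ltNyr.
rewrite !lee_fin => x0.
have mz (a : R) : measurable_fun setT (fun t => expR (a * (H 1 1 t - mu))).
  by apply: measurable_expR_affine; exact: mH.
have mZ2 : measurable_fun setT (fun t => (H 1 1 t - mu) ^+ 2).
  by apply: measurable_funX; apply: measurable_funB => //; exact: mH.
(* Pointwise [exp z <= 1 + D/4 z^2 + exp(2 z) / D] with [z = th (H - mu)]. On integration the outer
   terms give at most 2, so the lower bound 3 leaves at least 1 for [c] times the variance. *)
pose c := D / 4 * th ^+ 2.
have c0 : 0 < c by rewrite mulr_gt0 ?divr_gt0 ?exprn_gt0.
have D'0 : 0 <= D^-1 by rewrite invr_ge0 ltW.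
pose F1 t := c * (H 1 1 t - mu) ^+ 2.
pose F2 t := D^-1 * expR (2 * th * (H 1 1 t - mu)) + 1.
have mF1 : measurable_fun setT F1 by exact: measurable_funM.
have mF2 : measurable_fun setT F2.
  by apply: measurable_funD => //; exact: measurable_funM.
have F10 t : 0 <= F1 t by rewrite mulr_ge0 ?sqr_ge0// ltW.
have F20 t : 0 <= F2 t by rewrite addr_ge0// mulr_ge0// expR_ge0.
have le3 : (3%:E <= \int[P]_t (F1 t + F2 t)%:E)%E.
  apply: (le_trans lo); apply: ge0_le_integral_EFin.
  - exact: mz.
  - exact: measurable_funD.
  - by move=> t; exact: expR_ge0.
  - by move=> t; rewrite addr_ge0.
  apply: aeW => t; rewrite /F1 /F2; set y := H 1 1 t - mu; set z := th * y.
  have -> : 2 * th * y = 2 * z by rewrite /z mulrA.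
  have -> : c * y ^+ 2 = D / 4 * z ^+ 2 by rewrite /c /z; ring.
  have e1 : expR z <= 1 + z * expR z.
    have := expR_ge1Dx (- z); rewrite expRN => le.
    have ez := expR_gt0 z; have := ler_wpM2r (ltW ez) le.
    by rewrite mulVf ?gt_eqF//; lra.
  have e2 : z * expR z <= D / 4 * z ^+ 2 + D^-1 * expR (2 * z).
    rewrite (_ : expR (2 * z) = expR z ^+ 2); last by rewrite mulrC expRM_natr.
    rewrite -subr_ge0 (_ : _ - _ = (4 * D)^-1 * (D * z - 2 * expR z) ^+ 2).
      by rewrite mulr_ge0 ?sqr_ge0// invr_ge0 mulr_ge0// ltW.
    by field; rewrite gt_eqF.
  lra.
have le2 : (\int[P]_t (F2 t)%:E <= 2%:E)%E.
  rewrite (_ : 2 = D^-1 * D + 1); last by rewrite mulVf ?gt_eqF.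
  by apply: integral_affine_le => // t; exact: expR_ge0.
have I1 : (\int[P]_t (F1 t)%:E = (c * x)%:E)%E.
  rewrite EFinM -VE variance_integral -ge0_integralZl; last 4 first.
  - exact: measurableT.
  - exact/measurable_EFinP.
  - by move=> t _; rewrite lee_fin sqr_ge0.
  - by rewrite lee_fin ltW.
  by apply: eq_integral => t _; rewrite -EFinM.
have : (3%:E <= (c * x + 2)%:E)%E.
  apply: (le_trans le3); rewrite [in leRHS]EFinD -I1.
  under eq_integral do rewrite EFinD.
  rewrite ge0_integralD; last 5 first.
  - exact: measurableT.
  - by move=> t _; rewrite lee_fin.
  - exact/measurable_EFinP.
  - by move=> t _; rewrite lee_fin.
  - exact/measurable_EFinP.
  by rewrite leeD2l.
rewrite lee_fin => cx.
rewrite (_ : 4 / (D * th ^+ 2) = c^-1); last by rewrite /c; field; rewrite !gt_eqF.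
by rewrite -[leLHS]mulr1 ler_pdivrMl//; lra.
Qed.

(** With probability [exp(-M)] the corner weight exceeds [M]; the last-passage value then exceeds
    [mu + 1], and the squared deviation is at least 1. *)
Lemma variance_lower_small (M : R) : (0 < m)%N -> (0 < n)%N ->
  0 < M -> `|mu| + 1 <= M -> ((expR (- M))%:E <= V)%E.
Proof.
move=> m0 n0 M0 muM.
(* The complement of [[0, M]] also contains the negative half-line, which is discarded almost surely
   below. *)
pose A : set R := ~` `[0, M]%classic.
have mA : measurable A by apply: measurableC; exact: measurable_itv.
pose E := omega m n @^-1` A.
have mE : measurable E.
  by rewrite -[X in measurable X]setTI; exact: (measurable_funP (omega m n)).
have PE : P E = (expR (- M))%:E.
  transitivity (exponential_prob 1 A); first exact: (omega_law m0 n0 mA).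
  rewrite -(exponential_measureE ltr01).
  have mI : measurable (`[0, M]%classic : set (measurableTypeR R)).
    exact: measurable_itv.
  have := probability_setC (exponential_measure ltr01) mI.
  rewrite -/A => ->.
  rewrite [X in (_ - X)%E](_ : _ = (1 - (expR (- 1 * M))%:E)%E); last first.
    rewrite -exponential_prob_itv0c//; exact: exponential_measureE.
  transitivity ((1 - (1 - expR (- 1 * M)))%:E) => //.
  by congr EFin; rewrite mulN1r; ring.
rewrite -PE variance_integral.
have := integral_indicT P mE => <-.
apply: (@ge0_le_integral_EFin (\1_E)).
- exact: measurable_indic.
- by apply: measurable_funX; apply: measurable_funB => //; exact: mH.
- by move=> t.
- by move=> t; exact: sqr_ge0.
apply: filterS stationary_weights_ge0 => t w0; rewrite indicE.
case: (boolP (t \in E)) => [|_]; last by rewrite sqr_ge0.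
rewrite inE /E /A /= in_itv/= => /negP.
have w1 i j : (i <= m)%N -> (j <= n)%N -> (i, j) <> (0%N, 0%N) ->
    0 <= lattice_weight omega I J (i, j) t.
  by move=> im jn ij; apply: w0; exact: mem_rectangle.
have om0 : 0 <= omega m n t by have := w1 m n; case: m n m0 n0 => [|m'] [|n']// _ _; exact.
rewrite om0 /= -ltNge => Mom.
have omH : omega m n t <= H 1 1 t.
  clear om0 Mom; case: m n m0 n0 w1 {E PE mE w0} => [|m'] [|n']// _ _ w1.
  apply: (le_last_passage_weight (om := fun i j => omega i j t)) => [i j|i|j].
  - by move=> im jn; apply: (w1 i.+1 j.+1).
  - by move=> im; rewrite mul1r; apply: (w1 i.+1 0%N).
  - by move=> jn; rewrite mul1r; apply: (w1 0%N j.+1).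
have h1 : 1 <= H 1 1 t - mu by have := ler_norm mu; lra.
by rewrite -[leLHS](expr1n _ 2) lerXn2r// nnegrE; lra.
Qed.

End moments.

(** * Characteristic direction *)

Section characteristic_direction.
Context {R : realType} (rho a0 q : R) (m n : nat).
Hypotheses (rho0 : 0 < rho) (rho1 : rho < 1) (a00 : 0 < a0) (q1 : 1 <= q).
Hypotheses (mq : `|m%:R - q ^+ 3 * (1 - rho) ^+ 2| <= a0 * q ^+ 2)
  (nq : `|n%:R - q ^+ 3 * rho ^+ 2| <= a0 * q ^+ 2).

(** One constant dominating the inverse powers up to the third of both [rho] and [1 - rho]. Here [q]
    stands for the cube root of [N], which makes the hypotheses polynomial. *)
Definition inv_cubes : R := (rho^-1) ^+ 3 + ((1 - rho)^-1) ^+ 3.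
Local Notation Z := inv_cubes.

Let q0 : 0 < q. Proof. exact: lt_le_trans q1. Qed.
Let rho1' : 0 < 1 - rho. Proof. by rewrite subr_gt0. Qed.
Let a1 : 1 <= rho^-1. Proof. by rewrite invf_ge1// ltW. Qed.
Let b1 : 1 <= (1 - rho)^-1.
Proof. by rewrite invf_ge1// gerBl ltW. Qed.
Let ale (k : nat) : (k <= 3)%N -> (rho^-1) ^+ k <= (rho^-1) ^+ 3.
Proof. by move=> k3; rewrite ler_weXn2l. Qed.
Let ble (k : nat) : (k <= 3)%N -> ((1 - rho)^-1) ^+ k <= ((1 - rho)^-1) ^+ 3.
Proof. by move=> k3; rewrite ler_weXn2l. Qed.
Let qq : q ^+ 2 <= q ^+ 3. Proof. by rewrite ler_weXn2l. Qed.

Lemma inv_cubes_gt0 : 0 < Z.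
Proof. by rewrite addr_gt0// exprn_gt0// invr_gt0. Qed.

Let size_le (c : R) (k : nat) : 0 <= c <= 1 ->
  `|k%:R - q ^+ 3 * c| <= a0 * q ^+ 2 -> k%:R <= (1 + a0) * q ^+ 3.
Proof.
move=> /andP[c0 c1]; rewrite ler_norml => /andP[_ h].
have q30 : 0 <= q ^+ 3 by rewrite exprn_ge0// ltW.
have := ler_wpM2l q30 c1; have := ler_wpM2l (ltW a00) qq; lra.
Qed.

Let m_le : m%:R <= (1 + a0) * q ^+ 3.
Proof.
apply: size_le mq; rewrite sqr_ge0 expr_le1//; first by rewrite gerBl ltW.
by rewrite ltW.
Qed.

Let n_le : n%:R <= (1 + a0) * q ^+ 3.
Proof. by apply: size_le nq; rewrite sqr_ge0 expr_le1// ltW. Qed.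

(** At the exact characteristic point both quotients equal [q^3] and cancel, so only the deviations
    of order [q^2] remain. *)
Lemma rate_gap_le : `|rate_gap rho m n| <= a0 * Z * q ^+ 2.
Proof.
have -> : rate_gap rho m n =
    (m%:R - q ^+ 3 * (1 - rho) ^+ 2) * ((1 - rho)^-1) ^+ 2 -
    (n%:R - q ^+ 3 * rho ^+ 2) * (rho^-1) ^+ 2.
  by rewrite /rate_gap; field; rewrite !gt_eqF.
have nM (x c : R) : `|x * c ^+ 2| = `|x| * c ^+ 2.
  by rewrite normrM [X in _ * X]ger0_norm ?sqr_ge0.
apply: le_trans (ler_normB _ _) _; rewrite !nM.
have k0 : 0 <= a0 * q ^+ 2 by rewrite mulr_ge0 ?sqr_ge0// ltW.
have h1 := ler_pM (normr_ge0 _) (sqr_ge0 _) mq (ble (isT : (2 <= 3)%N)).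
have h2 := ler_pM (normr_ge0 _) (sqr_ge0 _) nq (ale (isT : (2 <= 3)%N)).
by apply: le_trans (lerD h1 h2) _; rewrite /inv_cubes; lra.
Qed.

Lemma cubic_mass_le : cubic_mass rho m n <= (1 + a0) * Z * q ^+ 3.
Proof.
rewrite /cubic_mass -!exprVn.
have h1 := ler_wpM2r (ltW (exprn_gt0 3 (_ : 0 < (1 - rho)^-1))) m_le.
have h2 := ler_wpM2r (ltW (exprn_gt0 3 (_ : 0 < rho^-1))) n_le.
rewrite !invr_gt0 in h1 h2.
apply: le_trans (lerD (h1 rho1') (h2 rho0)) _.
by rewrite /inv_cubes; lra.
Qed.

Lemma lpp_mean_le : `|lpp_mean rho m n| <= (1 + a0) * Z * q ^+ 3.
Proof.
have i1 : 0 <= (1 - rho)^-1 by rewrite invr_ge0 ltW.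
have i2 : 0 <= rho^-1 by rewrite invr_ge0 ltW.
rewrite /lpp_mean ger0_norm; last by rewrite addr_ge0// mulr_ge0.
apply: le_trans cubic_mass_le; rewrite /cubic_mass -!exprVn lerD//.
  by apply: ler_wpM2l => //; exact: (ble (isT : (1 <= 3)%N)).
by apply: ler_wpM2l => //; exact: (ale (isT : (1 <= 3)%N)).
Qed.

Definition tail_const (k : R) : R :=
  expR (k ^+ 2 * (a0 * Z) + 2 * k ^+ 3 * ((1 + a0) * Z)).

(** At [h = k / q] the powers of [q] cancel in both terms, so the bound depends on [rho], [a0] and
    [k] only. *)
Lemma tail_bound_le (k : R) : 0 <= k -> tail_bound rho m n (k / q) <= tail_const k.
Proof.
move=> k0; rewrite /tail_bound /tail_const ler_expR lerD//.
  have -> : k ^+ 2 * (a0 * Z) = (k / q) ^+ 2 * (a0 * Z * q ^+ 2).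
    by field; rewrite gt_eqF.
  by rewrite ler_wpM2l ?sqr_ge0//; exact: rate_gap_le.
have -> : 2 * k ^+ 3 * ((1 + a0) * Z) = 2 * (k / q) ^+ 3 * ((1 + a0) * Z * q ^+ 3).
  by field; rewrite gt_eqF.
rewrite ler_wpM2l//; last exact: cubic_mass_le.
by rewrite mulr_ge0// exprn_ge0// divr_ge0// ltW.
Qed.

(** For [q] above the threshold the deviation of [m] is at most half its main term, so
    [m >= q^3 (1 - rho)^2 / 2]; the surplus factor [1 / (1 - rho)] in the cubic term is at least
    1. *)
Lemma log_mgf_large (K : R) : 0 < K -> K / q < 1 - rho ->
  2 * a0 / (1 - rho) ^+ 2 <= q ->
  K ^+ 3 / 6 - K ^+ 2 * (a0 * Z / 2) <=
  log_mgf rho m n 0 (K / q) - K / q * lpp_mean rho m n.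
Proof.
move=> K0 Kq qa; have th0 : 0 <= K / q by rewrite divr_ge0// ltW.
have := log_mgf_cubic_lower m n rho0 rho1 th0 Kq => low.
have g1 : - (K ^+ 2 * (a0 * Z / 2)) <= (K / q) ^+ 2 / 2 * rate_gap rho m n.
  have -> : - (K ^+ 2 * (a0 * Z / 2)) = (K / q) ^+ 2 / 2 * - (a0 * Z * q ^+ 2).
    by field; rewrite gt_eqF.
  rewrite ler_wpM2l ?divr_ge0 ?sqr_ge0//.
  by have := rate_gap_le; rewrite ler_norml => /andP[].
have m2 : q ^+ 3 * (1 - rho) ^+ 2 / 2 <= m%:R.
  have : a0 * q ^+ 2 <= q ^+ 3 * (1 - rho) ^+ 2 / 2.
    rewrite ler_pdivrMr ?exprn_gt0// in qa.
    have := ler_wpM2r (sqr_ge0 q) qa.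
    by rewrite (_ : q * (1 - rho) ^+ 2 * q ^+ 2 = q ^+ 3 * (1 - rho) ^+ 2);
      [lra|ring].
  by move: mq; rewrite ler_norml => /andP[h _]; lra.
have g2 : K ^+ 3 / 6 <= (K / q) ^+ 3 / 3 * (m%:R / (1 - rho) ^+ 3).
  apply: (@le_trans _ _ ((K / q) ^+ 3 / 3 *
      (q ^+ 3 * (1 - rho) ^+ 2 / 2 / (1 - rho) ^+ 3))).
    rewrite (_ : _ * (_ / _ / _) = K ^+ 3 / 6 * (1 - rho)^-1); last first.
      by field; rewrite !gt_eqF.
    rewrite -[leLHS]mulr1 ler_wpM2l// divr_ge0// exprn_ge0// ltW//.
  rewrite ler_wpM2l ?divr_ge0 ?exprn_ge0// ler_wpM2r// invr_ge0 exprn_ge0//.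
  exact: ltW.
lra.
Qed.

End characteristic_direction.

(** * Variance of order [q^2] with explicit constants *)

Section characteristic_scaling.
Context d (T : measurableType d) (R : realType) (P : probability T R).
Variables (omega : nat -> nat -> {RV P >-> R}) (I J : nat -> {RV P >-> R}).
Variables (rho a0 q : R) (m n : nat).
Hypotheses (rho0 : 0 < rho) (rho1 : rho < 1) (a00 : 0 < a0) (q1 : 1 <= q).
Hypothesis omega_law : forall i j : nat, (0 < i)%N -> (0 < j)%N ->
  has_exponential_law 1 (omega i j).
Hypothesis I_law : forall i : nat, (0 < i)%N ->
  has_exponential_law (1 - rho) (I i).
Hypothesis J_law : forall j : nat, (0 < j)%N -> has_exponential_law rho (J j).
Hypothesis indep :
  mutually_independent_on [set x : nat * nat | x != (0%N, 0%N)]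
    (lattice_weight omega I J).
Hypotheses (mq : `|m%:R - q ^+ 3 * (1 - rho) ^+ 2| <= a0 * q ^+ 2)
  (nq : `|n%:R - q ^+ 3 * rho ^+ 2| <= a0 * q ^+ 2).
Local Notation H := (scaled_lpp omega I J 1 1 m n).
Local Notation g := (lpp_mean rho m n).
Local Notation mu := (fine ('E_P[H])%E).
Local Notation V := ('V_P[H])%E.

Let qgt0 : 0 < q. Proof. exact: lt_le_trans q1. Qed.
Let q20 : 0 < q ^+ 2. Proof. by rewrite exprn_gt0. Qed.

Section upper.
Variables (t0 : R) (t00 : 0 < t0) (t0r : 3 * t0 <= rho / 2)
  (t0r' : 3 * t0 <= (1 - rho) / 2).
Local Notation B := (tail_const rho a0 (3 * t0)).

Let t3 : 0 <= 3 * t0. Proof. by rewrite mulr_ge0// ltW. Qed.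

Let div_q (r : R) : 3 * t0 <= r -> 3 * t0 / q <= r.
Proof.
move=> tr; rewrite ler_pdivrMr//; apply: le_trans (tr) _.
by rewrite -[leLHS]mulr1 ler_wpM2l// (le_trans t3).
Qed.

Let tau0 : 0 < t0 / q. Proof. exact: divr_gt0. Qed.
Let tauh : 3 * (t0 / q) <= 3 * t0 / q. Proof. by rewrite mulrA. Qed.

Let tb : tail_bound rho m n (3 * t0 / q) <= B.
Proof. exact: tail_bound_le rho0 rho1 a00 q1 mq nq _ t3. Qed.

Lemma mean_scaling : `|mu - g| <= 16 / t0 * B * q.
Proof.
apply: (le_trans (stationary_mean_bound rho0 rho1 omega_law I_law J_law indep
  m n (div_q t0r) (div_q t0r') tau0 tauh)).
rewrite (_ : 16 / (t0 / q) = 16 / t0 * q); last by field; rewrite !gt_eqF.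
rewrite mulrAC ler_wpM2r ?(ltW qgt0)// ler_wpM2l//.
by rewrite divr_ge0// ltW.
Qed.

Lemma variance_upper_scaling :
  (V <= (512 / t0 ^+ 2 * (B + B ^+ 2) * q ^+ 2)%:E)%E.
Proof.
apply: (le_trans (stationary_variance_upper rho0 rho1 omega_law I_law J_law
  indep m n (div_q t0r) (div_q t0r') tau0 tauh)).
rewrite lee_fin.
rewrite (_ : 512 / (t0 / q) ^+ 2 = 512 / t0 ^+ 2 * q ^+ 2); last first.
  by field; rewrite !gt_eqF.
rewrite mulrAC; apply: ler_wpM2r; first exact: ltW q20.
have p512 : 0 < 512 :> R by rewrite ltr0n.
apply: ler_wpM2l; first exact: ltW (divr_gt0 p512 (exprn_gt0 2 t00)).
have tb0 : 0 <= tail_bound rho m n (3 * t0 / q) by exact: expR_ge0.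
by apply: lerD => //; apply: lerXn2r => //; rewrite nnegrE// expR_ge0.
Qed.

End upper.

Let shift (a : R) :
  (\int[P]_t (expR (a * (H t - mu)))%:E =
   (expR (a * (g - mu)))%:E * \int[P]_t (expR (a * (H t - g)))%:E)%E.
Proof.
rewrite -ge0_integralZl; last 4 first.
- exact: measurableT.
- apply/measurable_EFinP; apply: measurable_expR_affine.
  exact: measurable_scaled_lpp.
- by move=> t _; rewrite lee_fin expR_ge0.
- by rewrite lee_fin expR_ge0.
by apply: eq_integral => t _; rewrite -EFinM -expRD; congr (expR _)%:E; ring.
Qed.

Section lower.
Variables (K C1 : R) (K0 : 0 < K).
Hypotheses (Kr : 2 * K / q <= rho / 2) (Kr' : 2 * K / q <= (1 - rho) / 2).
Hypotheses (qa : 2 * a0 / (1 - rho) ^+ 2 <= q) (mean : `|mu - g| <= C1 * q).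
Hypothesis Klarge :
  2 + K * C1 <= K ^+ 3 / 6 - K ^+ 2 * (a0 * inv_cubes rho / 2).

(** Bound at exponent [2 K / q]: the first factor pays for recentring from [g] to [mu], the second
    is [stationary_upper_mgf] at [h = 2 K / q]. *)
Definition double_mgf_const : R :=
  expR (2 * K * C1) * (2 * tail_const rho a0 (2 * K)).
Local Notation D := double_mgf_const.

Lemma double_mgf_const_gt0 : 0 < D.
Proof. by apply: mulr_gt0; [|apply: mulr_gt0]; rewrite ?expR_gt0. Qed.

Let th0 : 0 < K / q. Proof. exact: divr_gt0. Qed.

Let mean' : - (C1 * q) <= mu - g <= C1 * q. Proof. by rewrite -ler_norml. Qed.

(** Recentring costs at most [K * C1] in the exponent; [Klarge] leaves at least 2, and
    [exp 2 >= 3]. *)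
Let mgf_lower : (3%:E <= \int[P]_t (expR (K / q * (H t - mu)))%:E)%E.
Proof.
rewrite shift; have /andP[mul muu] := mean'.
have th1 : K / q < 1 - rho.
  by have := Kr'; have := th0; rewrite -mulrA => ? ?; lra.
have low := stationary_mgf_lower rho0 rho1 omega_law I_law J_law indep m n
  (ltW th0) th1.
have low2 := log_mgf_large rho0 rho1 a00 q1 mq nq K0 th1 qa.
apply: (@le_trans _ _ ((expR (- (K * C1)))%:E *
  (expR (K ^+ 3 / 6 - K ^+ 2 * (a0 * inv_cubes rho / 2)))%:E)%E); last first.
  apply: lee_pmul.
  - by rewrite lee_fin expR_ge0.
  - by rewrite lee_fin expR_ge0.
  - rewrite lee_fin ler_expR (_ : - (K * C1) = K / q * - (C1 * q)); last first.
      by field; rewrite gt_eqF.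
    by apply: ler_wpM2l (ltW th0) _ _ _; lra.
  - by apply: le_trans low; rewrite lee_fin ler_expR.
rewrite -EFinM -expRD lee_fin.
apply: (@le_trans _ _ (expR 2)); first by have := expR_ge1Dx (2 : R); lra.
by rewrite ler_expR addrC lerBrDr.
Qed.

Let mgf_upper : (\int[P]_t (expR (2 * (K / q) * (H t - mu)))%:E <= D%:E)%E.
Proof.
rewrite shift mulrA; have /andP[mul muu] := mean'.
have h0 : 0 <= 2 * K / q by rewrite -mulrA mulr_ge0// ltW.
apply: (@le_trans _ _ ((expR (2 * K * C1))%:E *
  (2 * tail_bound rho m n (2 * K / q))%:E)%E).
  apply: lee_pmul.
  - by rewrite lee_fin expR_ge0.
  - by apply: integral_ge0 => t _; rewrite lee_fin expR_ge0.
  - rewrite lee_fin ler_expR (_ : 2 * K * C1 = 2 * K / q * (C1 * q)); last first.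
      by field; rewrite gt_eqF.
    by apply: ler_wpM2l h0 _ _ _; lra.
  - exact: stationary_upper_mgf rho0 rho1 omega_law I_law J_law indep m n
      _ _ Kr Kr' h0 (lexx _).
rewrite -EFinM lee_fin ler_wpM2l ?expR_ge0// ler_wpM2l//.
by apply: tail_bound_le => //; rewrite mulr_ge0// ltW.
Qed.

Lemma variance_lower_scaling : ((4 / (D * K ^+ 2) * q ^+ 2)%:E <= V)%E.
Proof.
have D0 := double_mgf_const_gt0.
rewrite (_ : _ * q ^+ 2 = 4 / (D * (K / q) ^+ 2)); last first.
  by field; rewrite !gt_eqF.
exact: variance_lower_of_mgf th0 D0 mgf_lower mgf_upper.
Qed.

End lower.

End characteristic_scaling.

(** * Choice of the constants, uniformly in [N] *)

Lemma powR_third_facts (R : realType) (N : R) : 1 <= N ->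
  [/\ 1 <= N `^ (1 / 3), (N `^ (1 / 3)) ^+ 3 = N &
      (N `^ (1 / 3)) ^+ 2 = N `^ (2 / 3)].
Proof.
move=> N1; have N0 : 0 <= N by exact: le_trans N1.
split.
- by rewrite -[leLHS](powRr0 N) ler_powR// divr_ge0.
- by rewrite -powR_mulrn ?powR_ge0// -powRrM divfK// powRr1.
- by rewrite -powR_mulrn ?powR_ge0// -powRrM mulrAC mul1r.
Qed.

Theorem theorem5p1 (R : realType) (rho a0 : R) (rho0 : 0 < rho)
    (rho1 : rho < 1) (a0_gt0 : 0 < a0) :
  exists2 C : R, 0 < C &
    forall (d : measure_display) (T : measurableType d) (P : probability T R)
      (omega : nat -> nat -> {RV P >-> R}) (I J : nat -> {RV P >-> R}),
      (forall i j : nat, (0 < i)%N -> (0 < j)%N ->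
        has_exponential_law 1 (omega i j)) ->
      (forall i : nat, (0 < i)%N -> has_exponential_law (1 - rho) (I i)) ->
      (forall j : nat, (0 < j)%N -> has_exponential_law rho (J j)) ->
      mutually_independent_on [set x : nat * nat | x != (0%N, 0%N)]
        (lattice_weight omega I J) ->
      forall (m n : nat) (N : R), (0 < m)%N -> (0 < n)%N -> 1 <= N ->
        Num.max `|m%:R - N * (1 - rho) ^+ 2| `|n%:R - N * rho ^+ 2|
          <= a0 * N `^ (2 / 3) ->
        ((C^-1 * N `^ (2 / 3))%:E <= 'V_P[stationary_lpp omega I J m n]
          <= (C * N `^ (2 / 3))%:E)%E.
Proof.
have rho1' : 0 < 1 - rho by rewrite subr_gt0.
have Z0 := inv_cubes_gt0 rho0 rho1.
have [t0 [t00 t0r t0r']] : exists t : R,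
    [/\ 0 < t, 3 * t <= rho / 2 & 3 * t <= (1 - rho) / 2].
  exists (rho * (1 - rho) / 6).
  have h1 : rho * (1 - rho) <= rho * 1 by rewrite ler_pM2l// gerBl ltW.
  have h2 : rho * (1 - rho) <= 1 * (1 - rho) by rewrite ler_pM2r// ltW.
  by split; [rewrite divr_gt0 ?mulr_gt0|lra|lra].
have [C1 C10 C1E] : exists2 C, 0 < C & C = 16 / t0 * tail_const rho a0 (3 * t0).
  by eexists; last reflexivity; rewrite mulr_gt0 ?divr_gt0 ?expR_gt0.
have [Cup Cup0 CupE] : exists2 C, 0 < C & C = 512 / t0 ^+ 2 *
    (tail_const rho a0 (3 * t0) + tail_const rho a0 (3 * t0) ^+ 2).
  eexists; last by reflexivity.
  have p512 : 0 < 512 :> R by rewrite ltr0n.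
  have B0 : 0 < tail_const rho a0 (3 * t0) by exact: expR_gt0.
  exact: mulr_gt0 (divr_gt0 p512 (exprn_gt0 2 t00)) (addr_gt0 B0 (exprn_gt0 2 B0)).
have aZ : 0 < a0 * inv_cubes rho by exact: mulr_gt0.
have [K K0 Klarge] : exists2 K, 0 < K &
    2 + K * C1 <= K ^+ 3 / 6 - K ^+ 2 * (a0 * inv_cubes rho / 2).
  (* The factor 6 cancels the 1/6, leaving [K^2 (C1 + 2)], which dominates [K C1 + 2] because
     [K >= 1]. *)
  pose K := 6 * (a0 * inv_cubes rho / 2 + C1 + 2).
  have K1 : 1 <= K by rewrite /K; lra.
  have KE : K ^+ 3 / 6 - K ^+ 2 * (a0 * inv_cubes rho / 2) = K ^+ 2 * (C1 + 2).
    by rewrite /K; field.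
  exists K; first by lra.
  rewrite KE; clearbody K; have K2 : K <= K ^+ 2 by rewrite expr2 ler_peMl//; lra.
  have C2 : 0 <= C1 + 2 by lra.
  by have := ler_wpM2r C2 K2; lra.
have D0 := double_mgf_const_gt0 rho a0 K C1.
have [c1 c10 c1E] : exists2 c, 0 < c &
    c = 4 / (double_mgf_const rho a0 K C1 * K ^+ 2).
  eexists; last by reflexivity.
  by rewrite divr_gt0// mulr_gt0// exprn_gt0.
have x1 : 0 < 2 * K / (3 * t0) by apply: divr_gt0; exact: mulr_gt0.
have x2 : 0 < 2 * a0 / (1 - rho) ^+ 2.
  by apply: divr_gt0; rewrite ?exprn_gt0// mulr_gt0.
(* Threshold between the two lower bounds: above [q0] the perturbation [2 K / q] is at most [3 * t0]
   and [log_mgf_large] applies; below it [q] is bounded. *)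
have [q0 [q00 q0K q0a]] : exists q,
    [/\ 0 < q, 2 * K / (3 * t0) <= q & 2 * a0 / (1 - rho) ^+ 2 <= q].
  by exists (2 * K / (3 * t0) + 2 * a0 / (1 - rho) ^+ 2); split; lra.
have aZ0 : 0 <= (1 + a0) * inv_cubes rho by rewrite mulr_ge0 ?(ltW Z0)//; lra.
(* For [q < q0] this dominates |g| + |mu - g| + 1. *)
have [M M0 ME] : exists2 M, 0 < M &
    M = (1 + a0) * inv_cubes rho * q0 ^+ 3 + C1 * q0 + 1.
  eexists; last by reflexivity.
  have h1 : 0 <= (1 + a0) * inv_cubes rho * q0 ^+ 3.
    by apply: mulr_ge0 aZ0 _; apply: exprn_ge0; exact: ltW.
  have h2 : 0 <= C1 * q0 by apply: mulr_ge0; exact: ltW.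
  exact: ltr_wpDl (addr_ge0 h1 h2) ltr01.
(* Dividing by [q0^2] turns the constant bound [exp(-M)] into a multiple of [q^2] for [q < q0]. *)
have [c2 c20 c2E] : exists2 c, 0 < c & c = expR (- M) / q0 ^+ 2.
  eexists; last by reflexivity.
  by rewrite divr_gt0 ?expR_gt0 ?exprn_gt0.
have ic1 : 0 < c1^-1 by rewrite invr_gt0.
have ic2 : 0 < c2^-1 by rewrite invr_gt0.
have [C [C0 CCup Cc1 Cc2]] : exists C,
    [/\ 0 < C, Cup <= C, C^-1 <= c1 & C^-1 <= c2].
  exists (Cup + c1^-1 + c2^-1); split; first by lra.
  - by lra.
  - by rewrite -[leRHS]invrK lef_pV2 ?posrE//; lra.
  - by rewrite -[leRHS]invrK lef_pV2 ?posrE//; lra.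
exists C => // d T P omega I J omL IL JL ind m n N m0 n0 N1 kN.
have [q1 q3 q2] := powR_third_facts N1.
set q := N `^ (1 / 3) in q1 q3 q2.
move: kN; rewrite -q2 -{1 2}q3 ge_max => /andP[mq nq].
have qgt0 : 0 < q by exact: lt_le_trans q1.
have q20 : 0 <= q ^+ 2 by rewrite exprn_ge0// ltW.
clearbody q; rewrite -(scaled_lpp11 omega I J).
have mean := mean_scaling rho0 rho1 a0_gt0 q1 omL IL JL ind mq nq t00 t0r t0r'.
rewrite -C1E in mean.
apply/andP; split; last first.
  apply: (le_trans (variance_upper_scaling rho0 rho1 a0_gt0 q1 omL IL JL ind
    mq nq t00 t0r t0r')).
  by rewrite -CupE lee_fin ler_wpM2r.
have [q0q|qq0] := leP q0 q.
  have Kq : 2 * K / q <= 3 * t0.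
    rewrite ler_pdivrMr// -ler_pdivrMl ?mulr_gt0// mulrC.
    exact: le_trans q0q.
  have qa : 2 * a0 / (1 - rho) ^+ 2 <= q by exact: le_trans q0q.
  apply: (le_trans _ (variance_lower_scaling rho0 rho1 a0_gt0 q1 omL IL JL ind
    mq nq K0 (le_trans Kq t0r) (le_trans Kq t0r') qa mean Klarge)).
  by rewrite -c1E lee_fin ler_wpM2r.
have muM : `|fine ('E_P[scaled_lpp omega I J 1 1 m n])%E| + 1 <= M.
  have gl := lpp_mean_le rho0 rho1 a0_gt0 q1 mq nq.
  have q3q0 : q ^+ 3 <= q0 ^+ 3.
    by rewrite lerXn2r ?nnegrE ?(ltW qgt0) ?(ltW q00)// ltW.
  have h1 := ler_wpM2l aZ0 q3q0; have h2 := ler_wpM2l (ltW C10) (ltW qq0).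
  have := ler_normD (fine ('E_P[scaled_lpp omega I J 1 1 m n])%E -
    lpp_mean rho m n) (lpp_mean rho m n); rewrite subrK => h3.
  rewrite ME lerD2r; apply: le_trans h3 _; rewrite addrC.
  by apply: lerD; [exact: le_trans gl h1|exact: le_trans mean h2].
apply: (le_trans _ (variance_lower_small rho0 rho1 omL IL JL ind m0 n0 M0 muM)).
rewrite lee_fin; apply: (@le_trans _ _ (c2 * q ^+ 2)).
  by rewrite ler_wpM2r.
have qq02 : q ^+ 2 <= q0 ^+ 2.
  by rewrite lerXn2r ?nnegrE ?(ltW qgt0) ?(ltW q00)// ltW.
by rewrite c2E mulrAC ler_pdivrMr ?exprn_gt0// ler_wpM2l// expR_ge0.
Qed.
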